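(* Let $X$ be a curve defined over $\overline{\mathbb{Q}}$. If $X$ admits a non-constant meromorphic function of odd degree defined over $\overline{\mathbb{Q}}$, then $X$ admits a Belyi function of odd degree.
   Context: A curve is a smooth irreducible projective algebraic curve. A Belyi function on $X$ is a non-constant morphism $X\to\mathbb{P}^1$ that is unbranched outside $\{0,1,\infty\}$. *)

(* Defs.v *)
(* Curves are embedded projective varieties over an algebraically closed field
   K, identified with their sets of K-points; K is algC in the application. *)
From mathcomp Require Import all_boot all_algebra all_field.
From mathcomp Require Import mpoly.

Set Implicit Arguments.
Unset Strict Implicit.
Unset Printing Implicit Defensive.

Import GRing.Theory.
Local Open Scope ring_scope.

Section Projective.
Variable K : fieldType.

(* P^n(K) is the set of lines of K^(n+1). *)
Definition proj (n : nat) := {L : {vspace 'rV[K]_n.+1} | \dim L == 1%N}.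

Definition line n (P : proj n) : {vspace 'rV[K]_n.+1} := val P.

Fact dim_vline1 n (v : 'rV[K]_n.+1) : v != 0 -> \dim <[v]> == 1%N.
Proof. by move=> v0; rewrite dim_vline v0. Qed.

Definition proj_of n (v : 'rV[K]_n.+1) (v0 : v != 0) : proj n :=
  exist _ <[v]>%VS (dim_vline1 v0).

Definition vec2 (x y : K) : 'rV[K]_2 := \row_(i < 2) [:: x; y]`_i.

Fact vec2_affine_neq0 x : vec2 x 1 != 0.
Proof.
by apply/eqP => /rowP /(_ ord_max) /eqP; rewrite !mxE /= oner_eq0.
Qed.

Fact vec2_infty_neq0 : vec2 1 0 != 0.
Proof.
by apply/eqP => /rowP /(_ ord0) /eqP; rewrite !mxE /= oner_eq0.
Qed.

(* Coordinate on P^1: x is [x : 1] and infinity is [1 : 0]. *)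
Definition affine_pt (x : K) : proj 1 := proj_of (vec2_affine_neq0 x).
Definition infty_pt : proj 1 := proj_of vec2_infty_neq0.

Definition mp_eval n (g : {mpoly K[n.+1]}) (v : 'rV[K]_n.+1) : K :=
  g.@[fun i => v 0 i].

(* The value at w of the differential of g at v. *)
Definition mp_diff n (g : {mpoly K[n.+1]}) (v w : 'rV[K]_n.+1) : K :=
  \sum_(i < n.+1) mp_eval g^`M(i) v * w 0 i.

Definition vanishes n (g : {mpoly K[n.+1]}) (P : proj n) : Prop :=
  forall v, v \in line P -> mp_eval g v = 0.

Definition zariski_closed n (X : proj n -> Prop) : Prop :=
  exists S : {mpoly K[n.+1]} -> Prop,
    (forall g, S g -> exists d : nat, g \is d.-homog) /\
    (forall P, X P <-> forall g, S g -> vanishes g P).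

Definition irreducible_closed n (X : proj n -> Prop) : Prop :=
  [/\ zariski_closed X,
      exists P, X P
    & forall Y Z : proj n -> Prop, zariski_closed Y -> zariski_closed Z ->
        (forall P, X P -> Y P \/ Z P) ->
        (forall P, X P -> Y P) \/ (forall P, X P -> Z P)].

(* Krull dimension 1: X is not a point, and each irreducible closed subset
   properly contained in X is a point. *)
Definition dimension_one n (X : proj n -> Prop) : Prop :=
  (exists P Q, [/\ X P, X Q & P <> Q]) /\
  (forall Z : proj n -> Prop, irreducible_closed Z ->
     (forall P, Z P -> X P) -> (exists P, X P /\ ~ Z P) ->
     exists P, forall Q, Z Q <-> Q = P).

(* Tangent space at P of the affine cone over X, cut out by the differentials
   of all forms vanishing on X.  It contains the line P, and its quotient by
   that line is (up to a twist) the Zariski tangent space of X at P. *)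
Definition cone_tangent n (X : proj n -> Prop) (P : proj n)
    (w : 'rV[K]_n.+1) : Prop :=
  forall (d : nat) (g : {mpoly K[n.+1]}), g \is d.-homog ->
    (forall Q, X Q -> vanishes g Q) ->
    forall v, v \in line P -> mp_diff g v w = 0.

(* For dim X = 1, smoothness at P means that the tangent space of X has
   dimension 1, i.e. that of the cone has dimension 2. *)
Definition smooth_curve_at n (X : proj n -> Prop) (P : proj n) : Prop :=
  exists T : {vspace 'rV[K]_n.+1},
    \dim T = 2 /\ forall w, w \in T <-> cone_tangent X P w.

Record curve n (X : proj n -> Prop) : Prop := Curve {
  curve_irreducible : irreducible_closed X;
  curve_dimension : dimension_one X;
  curve_smooth : forall P, X P -> smooth_curve_at X P }.

Definition forms_eval n m (A : 'I_m.+1 -> {mpoly K[n.+1]})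
    (v : 'rV[K]_n.+1) : 'rV[K]_m.+1 := \row_i mp_eval (A i) v.

Definition forms_diff n m (A : 'I_m.+1 -> {mpoly K[n.+1]})
    (v w : 'rV[K]_n.+1) : 'rV[K]_m.+1 := \row_i mp_diff (A i) v w.

(* Maps are total on P^n, but only their values on X matter.  The forms A,
   all of degree d, represent f on the open subset of X where they have no
   common zero; this subset may be empty. *)
Definition represents n m (X : proj n -> Prop) (f : proj n -> proj m)
    (d : nat) (A : 'I_m.+1 -> {mpoly K[n.+1]}) : Prop :=
  (forall i, A i \is d.-homog) /\
  (forall Q v, X Q -> v \in line Q -> forms_eval A v != 0 ->
     line (f Q) = <[forms_eval A v]>%VS).

Definition morphism n m (X : proj n -> Prop) (f : proj n -> proj m) : Prop :=
  forall P, X P -> exists d A, represents X f d A /\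
    exists2 v, v \in line P & forms_eval A v != 0.

Definition nonconstant n m (X : proj n -> Prop) (f : proj n -> proj m) : Prop :=
  exists P Q, [/\ X P, X Q & f P <> f Q].

(* On a smooth projective curve the meromorphic functions are the morphisms
   to P^1 that are not identically infinity. *)
Definition meromorphic n (X : proj n -> Prop) (f : proj n -> proj 1) : Prop :=
  morphism X f /\ exists P, X P /\ f P <> infty_pt.

(* Number of preimages of all but finitely many points of P^1.  For a
   non-constant f on a curve in characteristic 0 this is the degree of the
   corresponding extension of function fields. *)
Definition has_degree n (X : proj n -> Prop) (f : proj n -> proj 1)
    (d : nat) : Prop :=
  exists B : seq (proj 1), forall q, q \notin B ->
    exists s : seq (proj n),
      [/\ uniq s, size s = d & forall P, P \in s <-> X P /\ f P = q].

Definition odd_degree n (X : proj n -> Prop) (f : proj n -> proj 1) : Prop :=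
  exists2 d, has_degree X f d & odd d.

(* The differential of f at P, which sends the class of w modulo the line P to
   the class of forms_diff A v w modulo the line f P, is injective. *)
Definition unramified_at n m (X : proj n -> Prop) (f : proj n -> proj m)
    (P : proj n) : Prop :=
  exists d A v,
    [/\ represents X f d A, v \in line P, forms_eval A v != 0
      & forall w, cone_tangent X P w ->
          forms_diff A v w \in line (f P) -> w \in line P].

Definition unbranched_at n m (X : proj n -> Prop) (f : proj n -> proj m)
    (q : proj m) : Prop :=
  forall P, X P -> f P = q -> unramified_at X f P.

Definition belyi n (X : proj n -> Prop) (f : proj n -> proj 1) : Prop :=
  [/\ morphism X f, nonconstant X f
    & forall q, q \notin [:: affine_pt 0; affine_pt 1; infty_pt] ->
        unbranched_at X f q].

End Projective.

(* Main.v *)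
Require Import Defs.
From mathcomp Require Import all_boot all_order all_algebra all_field.
From mathcomp Require Import mpoly ring zify.
From Stdlib Require Import Classical ClassicalEpsilon.

(* A morphism f : X -> P^1 of odd degree is composed with odd degree rational
   self-maps of P^1 until it is branched over 0, 1 and infinity only.

   The branch locus of f is finite: by the Nullstellensatz the Hilbert function
   of X grows linearly, so each coordinate function x_i satisfies a polynomial
   relation F(f, x_i) = 0 on X, and where the x-derivative of a minimal relation
   does not vanish, the kernel of df kills dx_i.

   Irrational branch points are roots of some r over Q.  If deg r is odd, apply
   r; otherwise apply (X - a) r with a = c + r(c) / r'(c), whose derivative
   vanishes at the rational point c, so that in both cases fewer irrational
   branch points remain.

   Rational branch points may be taken to be positive integers b_i.  For a
   suitable highly divisible T > 0, let m_t be integers proportional to 1 / P'(t),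
   where P is the monic polynomial with roots 0, - T and the b_i.  Partial
   fractions show that \prod_t (X - t)^(m_t) is critical only at these roots and
   at infinity, which it sends to 0, 1 or infinity.  Exactly two of the m_t, those
   of 0 and - T, are odd, and they have opposite signs, so the degree is odd. *)

Set Implicit Arguments.
Unset Strict Implicit.
Unset Printing Implicit Defensive.

Import Order.TTheory GRing.Theory Num.Theory.
Local Open Scope ring_scope.

(** * Choice functions, linear dependence and Dickson's lemma *)

Lemma choice_fun (A B : Type) (P : A -> B -> Prop) :
  (forall x, exists y, P x y) -> exists f : A -> B, forall x, P x (f x).
Proof.
move=> H; exists (fun x => proj1_sig (constructive_indefinite_description _ (H x))).
by move=> x; case: constructive_indefinite_description.
Qed.

Lemma linear_dependence (K : fieldType) (I J : finType) (y : I -> J -> K) :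
  (#|J| < #|I|)%N ->
  exists c : I -> K, (exists i, c i != 0) /\ forall j, \sum_i c i * y i j = 0.
Proof.
move=> ltJI.
pose Y := \matrix_(i < #|I|, j < #|J|) y (enum_val i) (enum_val j).
have: kermx Y != 0.
  rewrite kermx_eq0 /row_free; apply: contraTneq ltJI => rY.
  by rewrite -leqNgt -rY rank_leq_col.
case/rowV0Pn => v /sub_kermxP vY /rV0Pn[i vi].
exists (fun i => v 0 (enum_rank i)); split.
  by exists (enum_val i); rewrite enum_valK.
move=> j; transitivity ((v *m Y) 0 (enum_rank j)); last by rewrite vY mxE.
rewrite mxE [RHS](reindex_onto enum_rank (@enum_val _ I)) /=; last by move=> *; rewrite enum_valK.
apply: eq_big => [k|k _]; first by rewrite enum_rankK eqxx.
by rewrite mxE !enum_rankK.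
Qed.

Lemma nondecreasing_subsequence (u : nat -> nat) :
  exists phi : nat -> nat, {homo phi : i j / (i < j)%N} /\
    {homo (u \o phi) : i j / (i <= j)%N}.
Proof.
(* Beyond every [N] lies an index whose value is least among all later ones: as long as a later
   value is smaller, move to it; [u N] bounds the number of moves. Iterating [t] picks such indices
   one after the other. *)
have tail N : exists k, (N <= k)%N /\ forall m, (k <= m)%N -> (u k <= u m)%N.
  have [b] := ubnP (u N); elim: b => // b IH in N *; rewrite ltnS => leb.
  case: (classic (forall m, (N <= m)%N -> (u N <= u m)%N)) => [H|]; first by exists N.
  move=> /not_all_ex_not[m Hm]; have [leNm /negP] := imply_to_and _ _ Hm.
  rewrite -ltnNge => lt_um.
  have [k [lemk Hk]] := IH m (leq_trans lt_um leb).
  by exists k; split=> //; apply: leq_trans leNm lemk.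
have [t Ht] := choice_fun tail.
pose phi i := t (iter i (fun k => (t k).+1) 0).
have phi_lt : {homo phi : i j / (i < j)%N}.
  apply: homo_ltn => [x y z|i]; first exact: ltn_trans.
  by rewrite /phi iterS; have [+ _] := Ht (t (iter i (fun k => (t k).+1) 0)).+1.
exists phi; split => // i j; rewrite leq_eqVlt => /predU1P[->//|/phi_lt/ltnW].
by rewrite /= /phi; have [_] := Ht (iter i (fun k => (t k).+1) 0); apply.
Qed.

(** The exponents are treated one at a time: a subsequence that is non-decreasing in the first [r]
    exponents has a further subsequence that is also non-decreasing in the next one. *)
Lemma dickson n (m : nat -> 'X_{1..n}) :
  exists i j, (i < j)%N /\ (m i <= m j)%MM.
Proof.
suff [phi [phi_lt phi_le]] : exists phi : nat -> nat, {homo phi : i j / (i < j)%N} /\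
    forall k : 'I_n, (k < n)%N -> forall i j, (i <= j)%N -> (m (phi i) k <= m (phi j) k)%N.
  exists (phi 0), (phi 1); split; first exact: phi_lt.
  by apply/mnm_lepP => k; apply: phi_le.
suff: forall r, exists phi : nat -> nat, {homo phi : i j / (i < j)%N} /\
    forall k : 'I_n, (k < r)%N -> forall i j, (i <= j)%N -> (m (phi i) k <= m (phi j) k)%N.
  by apply.
elim=> [|r [phi [phi_lt phi_le]]]; first by exists id; split.
case: (ltnP r n) => [ltrn|lenr]; last first.
  by exists phi; split=> // k _; apply: phi_le; apply: leq_trans lenr.
have [psi [psi_lt psi_le]] := nondecreasing_subsequence (fun i => m (phi i) (Ordinal ltrn)).
exists (phi \o psi); split=> [i j /psi_lt/phi_lt //|k].
rewrite ltnS leq_eqVlt => /predU1P[Ek|ltkr] i j leij.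
  by have -> : k = Ordinal ltrn by [apply: val_inj]; apply: psi_le.
apply: phi_le => //; move: leij; rewrite leq_eqVlt => /predU1P[->//|/psi_lt].
exact: ltnW.
Qed.

(** * Homogeneous ideals and the projective Nullstellensatz *)

Section Graded.
Variables (K : fieldType) (n : nat).
Local Notation S := {mpoly K[n]}.
Implicit Types (J : nat -> S -> Prop) (a b g : S).

Lemma dhomog_monomial d m : mdeg m = d -> 'X_[m] \is [in K[n], d.-homog].
Proof. by move=> dm; rewrite dhomogX; apply/eqP. Qed.

(* A homogeneous ideal, given by its graded pieces. *)
Record graded_ideal J : Prop := GradedIdeal {
  gi_homog : forall d g, J d g -> g \is d.-homog;
  gi_0 : forall d, J d 0;
  gi_add : forall d g h, J d g -> J d h -> J d (g + h);
  gi_mul : forall d e a g, a \is e.-homog -> J d g -> J (e + d)%N (a * g) }.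

Arguments gi_mul [J] _ [d e a g].

Definition gi_sub J J' := forall d g, J d g -> J' d g.

Definition full J k := forall g, g \is k.-homog -> J k g.

Lemma gi_scale J d c g : graded_ideal J -> J d g -> J d (c *: g).
Proof.
move=> gJ Jg; rewrite -mul_mpolyC; apply: (gi_mul _ (e := 0)) => //.
by rewrite -[c%:MP]mulr1 mul_mpolyC; apply/dhomogZ/dhomog1.
Qed.

Lemma gi_opp J d g : graded_ideal J -> J d g -> J d (- g).
Proof. by move=> gJ Jg; rewrite -scaleN1r; apply: gi_scale. Qed.

Lemma gi_subr J d g h : graded_ideal J -> J d g -> J d h -> J d (g - h).
Proof. by move=> gJ Jg Jh; apply: gi_add => //; apply: gi_opp. Qed.

Lemma gi_sum J d (I : Type) (r : seq I) (P : pred I) (F : I -> S) :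
  graded_ideal J -> (forall i, P i -> J d (F i)) -> J d (\sum_(i <- r | P i) F i).
Proof. by move=> gJ JF; elim/big_rec: _ => [|i g /JF Ji Jg]; [apply: gi_0|apply: gi_add]. Qed.

Lemma gi_mulr J d e a g :
  graded_ideal J -> a \is e.-homog -> J d g -> J (d + e)%N (g * a).
Proof. by rewrite mulrC addnC => *; apply: gi_mul. Qed.

(** Noetherianity by a Gröbner argument. If every step were strict, pick in each [J k.+1] outside
    [J k] a form [x k] with minimal leading monomial. By Dickson, the leading monomial of some [x i]
    divides that of a later [x j]; subtracting a multiple of [x i], which lies in [J j], cancels the
    leading term of [x j] and contradicts minimality. *)
Lemma gideal_acc (J : nat -> nat -> S -> Prop) :
  (forall k, graded_ideal (J k)) -> (forall k, gi_sub (J k) (J k.+1)) ->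
  exists k, gi_sub (J k.+1) (J k).
Proof.
move=> gJ incJ; apply: NNPP => /not_ex_all_not noJ.
have incJ' i j : (i <= j)%N -> gi_sub (J i) (J j).
  elim: j => [|j IH]; first by rewrite leqn0 => /eqP ->.
  rewrite leq_eqVlt => /predU1P[-> //|]; rewrite ltnS => /IH H d g /H; exact: incJ.
pose Q k (x : nat * S) := J k.+1 x.1 x.2 /\ ~ J k x.1 x.2.
have ex_min k : exists x, Q k x /\
    forall y, Q k y -> ~ (mlead y.2 < mlead x.2)%O.
  have [y Qy] : exists y, Q k y.
    apply: NNPP => nQ; apply: (noJ k) => d g Jg; apply: NNPP => nJg.
    by apply: nQ; exists (d, g).
  move Em : (mlead y.2) => m; elim/(well_founded_ind (@ltom_wf n)): m => m IH in y Qy Em *.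
  case: (classic (exists2 z, Q k z & (mlead z.2 < m)%O)) => [[z Qz ltz]|nz].
    by apply: (IH _ ltz z).
  by exists y; split=> // z Qz ltz; apply: nz; exists z => //; rewrite -Em.
have [x Hx] := choice_fun ex_min.
have x0 k : (x k).2 != 0.
  apply/eqP => xk0; have [[_]] := Hx k; rewrite xk0; case; exact: gi_0.
have hx k : (x k).2 \is ((x k).1).-homog.
  by have [[/(gi_homog (gJ _))]] := Hx k.
have [i [j [ltij lem]]] := dickson (fun k => mlead (x k).2).
set gi := (x i).2 in lem; set gj := (x j).2 in lem.
pose c := gj@_(mlead gj) / gi@_(mlead gi).
pose m := (mlead gj - mlead gi)%MM.
have Em : (m + mlead gi)%MM = mlead gj by rewrite /m submK.
have mdeg_x k : mdeg (mlead (x k).2) = (x k).1.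
  by move/dhomogP: (hx k); apply; apply: mlead_supp.
have [[Jgj nJgj] min] := Hx j.
pose t := c *: ('X_[m] * gi).
have Jt : J j (x j).1 t.
  apply: gi_scale => //; apply: (incJ' i.+1 j) => //.
  have -> : (x j).1 = (mdeg m + (x i).1)%N by rewrite -!mdeg_x -mdegD Em.
  by apply: gi_mul; [|exact: dhomog_monomial|have [[]] := Hx i].
have lci : gi@_(mlead gi) != 0 by rewrite mleadc_eq0 x0.
have lcj : gj@_(mlead gj) != 0 by rewrite mleadc_eq0 x0.
apply: (min ((x j).1, gj - t)) => /=.
  split=> /= [|Jd].
    by apply: gi_subr => //; apply: incJ.
  by apply: nJgj; rewrite -/gj -(subrK t gj); apply: gi_add.
have nz : gj - t != 0.
  apply/eqP => /subr0_eq E; apply: nJgj; rewrite -/gj E; exact: Jt.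
rewrite lt_neqAle -/gj; apply/andP; split.
  apply: contraNneq nz => E; rewrite -mleadc_eq0 E mcoeffB mcoeffZ.
  have -> : ('X_[m] * gi)@_(mlead gj) = gi@_(mlead gi).
    by rewrite -Em mulrC mcoeffMX.
  by rewrite divfK // subrr.
apply: le_trans (mleadB_le _ _) _; rewrite leUx lexx /=.
apply: le_trans (mleadZ_le _ _) _.
by rewrite mleadM ?x0 // ?mleadXm ?Em // -msize_poly_eq0 msizeX.
Qed.

(** In a non-empty class without maximal member, choice produces a strictly ascending chain, which
    [gideal_acc] excludes. *)
Lemma gideal_maximal (C : (nat -> S -> Prop) -> Prop) :
  (forall J, C J -> graded_ideal J) -> (exists J, C J) ->
  exists J, C J /\ forall J', C J' -> gi_sub J J' -> gi_sub J' J.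
Proof.
move=> gC [J0 CJ0]; apply: NNPP => nomax.
pose T := {J | C J}.
have step (J : T) : exists J' : T, gi_sub (sval J) (sval J') /\ ~ gi_sub (sval J') (sval J).
  apply: NNPP => no; apply: nomax; exists (sval J); split; first exact: svalP.
  move=> J' CJ' sub; apply: NNPP => nsub; apply: no.
  by exists (exist _ J' CJ').
have [next Hnext] := choice_fun step.
pose s k := iter k next (exist _ J0 CJ0 : T).
have [k|k|k] := @gideal_acc (fun k => sval (s k)).
- by apply: gC; apply: svalP.
- by have [] := Hnext (s k).
- by have [_] := Hnext (s k).
Qed.

Lemma mnm_posP d (m : 'X_{1..n}) :
  mdeg m = d.+1 -> exists i m', m = (U_(i) + m')%MM.
Proof.
move=> dm; have [i mi] : exists i, (m i != 0)%N.
  apply/existsP; rewrite -negb_forall; apply/negP => /forallP m0.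
  by move: dm; rewrite mdegE big1 // => i _; apply/eqP; apply: m0.
exists i, (m - U_(i))%MM; rewrite addmC submK //; apply/mnm_lepP => j.
by rewrite mnm1E; case: eqP => // <-; rewrite lt0n.
Qed.

Lemma mnm_split k l (m : 'X_{1..n}) : mdeg m = (k + l)%N ->
  exists m1 m2, [/\ m = (m1 + m2)%MM, mdeg m1 = k & mdeg m2 = l].
Proof.
elim: k m => [|k IH] m dm; first by exists 0%MM, m; rewrite add0m mdeg0.
have [i [m' Em]] := mnm_posP dm.
have [|m1 [m2 [Em' d1 d2]]] := IH m'.
  by move: dm; rewrite Em mdegD mdeg1 => -[].
by exists (U_(i) + m1)%MM, m2; rewrite Em Em' addmA mdegD mdeg1 d1.
Qed.

Lemma fullP J k : graded_ideal J ->
  (forall m, mdeg m = k -> J k 'X_[m]) -> full J k.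
Proof.
move=> gJ Jm g /dhomogP hg; rewrite (mpolyE g) big_seq.
by apply: gi_sum => // m /hg dm; apply: gi_scale => //; apply: Jm.
Qed.

Lemma full_mul J k l : graded_ideal J ->
  (forall m1 m2, mdeg m1 = k -> mdeg m2 = l -> J (k + l)%N ('X_[m1] * 'X_[m2])) ->
  full J (k + l)%N.
Proof.
move=> gJ Jm; apply: fullP => // m /mnm_split[m1 [m2 [-> d1 d2]]].
by rewrite mpolyXD; apply: Jm.
Qed.

Lemma full_up J k l : graded_ideal J -> full J k -> full J (k + l)%N.
Proof.
move=> gJ fJ; apply: full_mul => // m1 m2 d1 d2; apply: gi_mulr => //.
  exact: dhomog_monomial.
by apply/fJ/dhomog_monomial.
Qed.

(** The graded ideal J + (a) with [a] of degree [e]. The test [e <= d] guards the truncated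
    subtraction: below degree [e] the multiplier of [a] must be 0. *)
Definition gi_adjoin J a e (d : nat) g :=
  exists j b, [/\ J d j, if (e <= d)%N then b \is (d - e)%N.-homog else b == 0
                & g = j + b * a].

Lemma gi_adjoin_graded J a e :
  graded_ideal J -> a \is e.-homog -> graded_ideal (gi_adjoin J a e).
Proof.
move=> gJ ha; split.
- move=> d g [j [b [/(gi_homog gJ) hj hb ->]]]; apply: dhomogD => //.
  case: leqP hb => [led hb|_ /eqP ->]; last by rewrite mul0r dhomog0.
  by rewrite -(subnK led); apply: dhomogM.
- move=> d; exists 0, 0; rewrite mul0r addr0 eqxx dhomog0 if_same; split=> //.
  exact: gi_0.
- move=> d _ _ [j [b [Jj hb ->]]] [j' [b' [Jj' hb' ->]]].
  exists (j + j'), (b + b'); split; [exact: gi_add| |by ring].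
  case: leqP hb hb' => _ hb hb'; first exact: dhomogD.
  by rewrite (eqP hb) (eqP hb') addr0.
- move=> d e' c _ hc [j [b [Jj hb ->]]]; exists (c * j), (c * b).
  split; [exact: gi_mul| |by ring].
  case: leqP hb => [led hb|_ /eqP ->].
    by rewrite (leq_trans led) ?leq_addl // -addnBA //; apply: dhomogM.
  by rewrite mulr0 eqxx dhomog0 if_same.
Qed.

Lemma gi_adjoin_sub J a e : gi_sub J (gi_adjoin J a e).
Proof.
move=> d g Jg; exists g, 0; rewrite mul0r addr0 eqxx dhomog0 if_same; split=> //.
Qed.

Lemma gi_adjoin_mem J a e : graded_ideal J -> gi_adjoin J a e e a.
Proof.
move=> gJ; exists 0, 1; rewrite mul1r add0r leqnn subnn dhomog1; split=> //.
exact: gi_0.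
Qed.

Lemma gi_adjoinS J a d g : gi_adjoin J a 1 d.+1 g ->
  exists j b, [/\ J d.+1 j, b \is d.-homog & g = j + b * a].
Proof. by case=> j [b]; rewrite /= subSS subn0 => H; exists j, b. Qed.

Definition prime_gi J := forall d e a b, a \is d.-homog -> b \is e.-homog ->
  J (d + e)%N (a * b) -> J d a \/ J e b.

(** The ideal contains no power of the irrelevant ideal; this is the properness that the projective
    Nullstellensatz requires. *)
Definition proper_gi J := forall k, ~ full J k.

(** If neither [a] nor [b] is in J, maximality makes J + (a) full in some degree k and J + (b) full
    in some degree l. Products of their elements lie in J + (ab) = J, so J would be full in degree k
    + l. *)
Lemma maximal_prime J : graded_ideal J -> proper_gi J ->
  (forall J', graded_ideal J' -> proper_gi J' -> gi_sub J J' -> gi_sub J' J) ->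
  prime_gi J.
Proof.
move=> gJ pJ mJ.
have fullA d a : a \is d.-homog -> ~ J d a -> exists k, full (gi_adjoin J a d) k.
  move=> ha nJa; apply: NNPP => nf; apply: nJa.
  apply: (mJ (gi_adjoin J a d)); [exact: gi_adjoin_graded| |exact: gi_adjoin_sub|exact: gi_adjoin_mem].
  by move=> k fk; apply: nf; exists k.
move=> d e a b ha hb Jab; apply: NNPP => /not_or_and[/(fullA _ _ ha)[k fk] /(fullA _ _ hb)[l fl]].
apply: (pJ (k + l)%N); apply: full_mul => // m1 m2 d1 d2.
have hm1 : 'X_[m1] \is [in K[n], k.-homog] by exact: dhomog_monomial.
have hm2 : 'X_[m2] \is [in K[n], l.-homog] by exact: dhomog_monomial.
have [j1 [b1 [Jj1 hb1 E1]]] := fk _ hm1; have [j2 [b2 [Jj2 hb2 E2]]] := fl _ hm2.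
have -> : 'X_[m1] * 'X_[m2] = j1 * 'X_[m2] + 'X_[m1] * j2 - j1 * j2 + b1 * b2 * (a * b) :> S.
  by rewrite E1 E2; ring.
apply: gi_add => //; first (apply: gi_subr => //; first apply: gi_add => //).
- exact: gi_mulr.
- exact: gi_mul.
- by apply: gi_mul => //; apply: gi_homog Jj1.
case: leqP hb1 => [ledk hb1|_ /eqP ->]; last by rewrite !mul0r; apply: gi_0.
case: leqP hb2 => [leel hb2|_ /eqP ->]; last by rewrite !(mulr0, mul0r); apply: gi_0.
have -> : (k + l = (k - d) + (l - e) + (d + e))%N by lia.
by apply: gi_mul => //; apply: dhomogM.
Qed.

(** The homogenization b^N p(a/b), meaningful when p has degree at most N. *)
Definition hpoly N (p : {poly K}) a b : S :=
  \sum_(i < N.+1) p`_i *: (a ^+ i * b ^+ (N - i)).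

Lemma hpoly_homog N p d a b :
  a \is d.-homog -> b \is d.-homog -> hpoly N p a b \is (d * N).-homog.
Proof.
move=> ha hb; apply: rpred_sum => i _; apply: dhomogZ.
have -> : (d * N = d * i + d * (N - i))%N by rewrite -mulnDr subnKC // -ltnS.
by apply: dhomogM; apply: dhomogMn.
Qed.

Lemma hpoly_linear N (p : {poly K}) c a b : (size p <= N.+1)%N ->
  hpoly N.+1 (('X - c%:P) * p) a b = (a - c *: b) * hpoly N p a b.
Proof.
move=> sp; rewrite /hpoly [RHS]mulrBl -scalerAl !mulr_sumr scaler_sumr.
under eq_bigr do rewrite mulrBl coefB coefXM coefCM scalerBl.
rewrite sumrB; congr (_ - _).
  rewrite big_ord_recl scale0r add0r; apply: eq_bigr => i _ /=.
  by rewrite subSS exprS -scalerAr mulrA.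
rewrite big_ord_recr /= nth_default // mulr0 scale0r addr0.
apply: eq_bigr => i _; rewrite -scalerAr scalerA; congr (_ *: _).
by rewrite mulrCA -exprS subSn // -ltnS.
Qed.

End Graded.

(** * The projective Nullstellensatz over an algebraically closed field *)

Section Nullstellensatz.
Variables (K : closedFieldType) (n : nat).
Local Notation S := {mpoly K[n.+1]}.

Lemma prime_gi_expr (J : nat -> S -> Prop) d a k : graded_ideal J -> prime_gi J -> proper_gi J ->
  a \is d.-homog -> J (d * k)%N (a ^+ k) -> J d a.
Proof.
move=> gJ prJ pJ ha; elim: k => [|k IH].
  rewrite muln0 expr0 => J1; case: (pJ 0%N) => g hg.
  by rewrite -[g]mulr1; apply: (gi_mul _ (e := 0)).
by rewrite mulnS exprS => /prJ; case=> //; apply: dhomogMn.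
Qed.

Lemma dhomog_coord_inj k (u : S) : u \is k.-homog ->
  (forall m : 'X_{1..n.+1 < k.+1}, u@_m = 0) -> u = 0.
Proof.
move=> hu u0; apply/mpolyP => m; rewrite mcoeff0.
have [dm|dm] := eqVneq (mdeg m) k; last by apply: dhomog_nemf_coeff hu dm.
have bm : (mdeg m < k.+1)%N by rewrite dm.
exact: (u0 (BMultinom bm)).
Qed.

(** Over a closed field the binary form b^N p(a/b) is a constant times a product of factors a - c b
    and a power of [b]. A prime ideal containing it but not [b] contains one of the factors a - c
    b. *)
Lemma prime_binary (J : nat -> S -> Prop) N (p : {poly K}) a b :
  graded_ideal J -> prime_gi J -> proper_gi J ->
  a \is 1.-homog -> b \is 1.-homog -> ~ J 1%N b ->
  p != 0 -> (size p <= N.+1)%N -> J N (hpoly N p a b) ->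
  exists c, J 1%N (a - c *: b).
Proof.
move=> gJ prJ pJ ha hb nb; elim: N p => [|N IH] p p0 sp.
  have /size_poly1P[c c0 ->] : size p == 1%N by rewrite eqn_leq sp lt0n size_poly_eq0.
  rewrite /hpoly big_ord_recl big_ord0 addr0 coefC /= expr0 mulr1 => Jc.
  case: nb; apply: (prime_gi_expr (k := 0)) => //.
  by rewrite muln0 -[b ^+ 0](scalerK c0); apply: gi_scale.
have [/size_poly1P[c c0 ->]|s1] := boolP (size p == 1%N).
  rewrite /hpoly big_ord_recl big1 ?addr0 => [|i _]; last by rewrite coefC /= scale0r.
  rewrite coefC /= mul1r => Jc; case: nb; apply: (prime_gi_expr (k := N.+1)) => //.
  by rewrite mul1n -[b ^+ _](scalerK c0); apply: gi_scale.
have [c /factor_theorem[q Eq]] := closed_rootP _ s1.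
have q0 : q != 0 by apply: contraNneq p0 => E; rewrite Eq E mul0r.
move: sp; rewrite Eq mulrC size_monicM ?monicXsubC // size_XsubC => sq.
rewrite hpoly_linear //; case/(prJ 1%N N) => //.
- by apply: rpredB => //; apply: dhomogZ.
- by rewrite -{2}[N]mul1n; apply: hpoly_homog.
- by exists c.
- exact: IH.
Qed.

(** A maximal proper J above [J0] is prime and misses some ['X_i0]. It is shown to contain
    ['X_i - c i *: 'X_i0] for every i, so that [c] is the required zero. *)
Lemma nullstellensatz (J0 : nat -> S -> Prop) :
  graded_ideal J0 -> proper_gi J0 ->
  exists v : 'rV[K]_n.+1, v != 0 /\ forall d g, J0 d g -> mp_eval g v = 0.
Proof.
move=> gJ0 pJ0.
have [||J [[gJ pJ sJ] mJ]] := @gideal_maximal K n.+1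
    (fun J => [/\ graded_ideal J, proper_gi J & gi_sub J0 J]).
- by move=> J [].
- by exists J0; split.
have prJ : prime_gi J.
  apply: maximal_prime => // J' gJ' pJ' sub; apply: mJ => //; split=> //.
  by move=> d g /sJ/sub.
suff [v [v0 Hv]] : exists v : 'rV[K]_n.+1, v != 0 /\ forall d g, J d g -> mp_eval g v = 0.
  by exists v; split=> // d g /sJ/Hv.
have hX i : 'X_i \is [in K[n.+1], 1.-homog] by apply: dhomog_monomial; rewrite mdeg1.
have [i0 nJ0] : exists i0, ~ J 1%N ('X_i0).
  apply: NNPP => /not_ex_not_all HX; apply: (pJ 1%N); apply: fullP => // m.
  by move/eqP/mdeg1P=> [i /eqP ->]; apply: HX.
have [k fk] : exists k, full (gi_adjoin J 'X_i0 1) k.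
  apply: NNPP => nf; apply: nJ0.
  apply: (mJ (gi_adjoin J 'X_i0 1)); first split.
  - exact: gi_adjoin_graded.
  - by move=> k fk; apply: nf; exists k.
  - by move=> d g /sJ; apply: gi_adjoin_sub.
  - exact: gi_adjoin_sub.
  - exact: gi_adjoin_mem.
(* Since J + ('X_i0) is full in degree k, modulo J every form of degree m + k is ['X_i0 ^+ m] times
   a form of degree k. *)
have red m (g : S) : g \is (m + k).-homog ->
    exists u, u \is k.-homog /\ J (m + k)%N (g - 'X_i0 ^+ m * u).
  elim: m g => [|m IH] g hg.
    by exists g; rewrite expr0 mul1r subrr; split=> //; apply: gi_0.
  have /gi_adjoinS[j [b [Jj hb ->]]] : gi_adjoin J 'X_i0 1 (m + k).+1 g.
    rewrite -addSn addnC; apply: (full_up _ fk); last by rewrite addnC.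
    exact: gi_adjoin_graded.
  have [u [hu Ju]] := IH b hb; exists u; split=> //.
  have -> : j + b * 'X_i0 - 'X_i0 ^+ m.+1 * u = j + 'X_i0 * (b - 'X_i0 ^+ m * u) by rewrite exprS; ring.
  by apply: gi_add => //; apply: (gi_mul _ (e := 1)).
(* With M the number of monomials of degree at most k, the M + 1 forms
   ['X_i ^+ j * 'X_i0 ^+ (M + k - j)] reduce to M + 1 forms of degree k, which are dependent. The
   dependence is a binary form in J. *)
have lin i : exists c, J 1%N ('X_i - c *: 'X_i0).
  pose T : finType := 'X_{1..n.+1 < k.+1}; pose M := #|T|.
  have hm (j : 'I_M.+1) : 'X_i ^+ j * 'X_i0 ^+ (M + k - j) \is [in K[n.+1], (M + k).-homog].
    have := dhomogM (dhomogMn j (hX i)) (dhomogMn (M + k - j) (hX i0)).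
    by rewrite !mul1n subnKC // (leq_trans _ (leq_addr _ _)) // -ltnS.
  have [u Hu] := choice_fun (fun j => red M _ (hm j)).
  have [|c [[j0 cj0] Hc]] := @linear_dependence K 'I_M.+1 T (fun j m => (u j)@_m).
    by rewrite card_ord.
  have Eu : \sum_j c j *: u j = 0.
    apply: (@dhomog_coord_inj k); first by apply: rpred_sum => j _; apply: dhomogZ; have [] := Hu j.
    by move=> m; rewrite raddf_sum /= -[RHS](Hc m); apply: eq_bigr => j _; rewrite mcoeffZ.
  pose p := \poly_(j < M.+1) c (inord j).
  apply: (@prime_binary J (M + k) p) => //.
  - by apply/eqP => /polyP/(_ j0); rewrite coef_poly ltn_ord inord_val coef0; apply/eqP.
  - by apply: leq_trans (size_poly _ _) _; rewrite ltnS leq_addr.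
  have -> : hpoly (M + k) p 'X_i 'X_i0 = \sum_(j < M.+1)
       c j *: ('X_i ^+ j * 'X_i0 ^+ (M + k - j) - 'X_i0 ^+ M * u j).
    under [RHS]eq_bigr do rewrite scalerBr [X in _ - X]scalerAr.
    rewrite sumrB -mulr_sumr Eu mulr0 subr0 /hpoly.
    have leM : (M.+1 <= (M + k).+1)%N by rewrite ltnS leq_addr.
    transitivity (\sum_(j < (M + k).+1 | (j < M.+1)%N)
        c (inord j) *: ('X_i ^+ j * 'X_i0 ^+ (M + k - j) : S)).
      rewrite [RHS]big_mkcond; apply: eq_bigr => j _.
      by rewrite coef_poly; case: ifP => // _; rewrite scale0r.
    rewrite -(big_ord_widen _ (fun j => c (inord j) *: ('X_i ^+ j * 'X_i0 ^+ (M + k - j))) leM).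
    by apply: eq_bigr => j _; rewrite inord_val.
  by apply: gi_sum => // j _; apply: gi_scale => //; have [] := Hu j.
have [c Hc] := choice_fun lin.
have ci0 : c i0 = 1.
  apply/eqP; rewrite eq_sym -subr_eq0; apply/negPn/negP => c1; apply: nJ0.
  rewrite -['X_i0](scalerK c1); apply: gi_scale => //.
  by rewrite scalerBl scale1r; apply: Hc.
exists (\row_i c i); split.
  by apply/eqP => /rowP/(_ i0)/eqP; rewrite !mxE ci0 oner_eq0.
have ev : meval (fun i => (\row_i c i) 0 i) =1 meval c :> (S -> K).
  by move=> g; apply: meval_eq => i; rewrite mxE.
(* Modulo J a monomial equals its value at [c] times a power of ['X_i0]. Hence g in J gives [g.@[c]
   *: 'X_i0 ^+ d] in J, and the value must be 0 because ['X_i0] is not in the prime J. *)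
suff mon (m : 'X_{1..n.+1}) : J (mdeg m) ('X_[m] - ('X_[m] : S).@[c] *: 'X_i0 ^+ mdeg m).
  move=> d g Jg; rewrite /mp_eval ev; apply/eqP/negPn/negP => gc.
  apply: nJ0; apply: (prime_gi_expr (k := d)) => //; rewrite mul1n.
  rewrite -['X_i0 ^+ d](scalerK gc); apply: gi_scale => //.
  rewrite -[X in J d X](subKr g); apply: gi_subr => //.
  have /dhomogP hg := gi_homog gJ Jg.
  rewrite [X in X - _](mpolyE g) [in X in _ - X](mpolyE g) !raddf_sum /= scaler_suml -sumrB big_seq.
  apply: gi_sum => // m /hg dm; rewrite mevalZ -scalerA -scalerBr; apply: gi_scale => //.
  by have := mon m; rewrite dm.
move: {-1}(mdeg m) (erefl (mdeg m)) => d; elim: d m => [|d IH] m dm.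
  by move/eqP: dm; rewrite mdeg_eq0 => /eqP ->; rewrite mpolyX0 meval1 scale1r subrr; apply: gi_0.
have [i [m' Em]] := mnm_posP dm.
have dm' : mdeg m' = d by move: dm; rewrite Em mdegD mdeg1 => -[].
rewrite Em mpolyXD mevalM mevalXU.
have -> : 'X_i * 'X_[m'] - (c i * ('X_[m'] : S).@[c]) *: 'X_i0 ^+ d.+1 =
   ('X_i - c i *: 'X_i0) * 'X_[m'] + (c i *: 'X_i0) * ('X_[m'] - ('X_[m'] : S).@[c] *: 'X_i0 ^+ d).
  by rewrite -!mul_mpolyC mpolyCM exprS; ring.
apply: gi_add => //.
  by apply: (gi_mulr (d := 1) (e := d)) => //; apply: dhomog_monomial.
by apply: (gi_mul _ (e := 1)); [|apply: dhomogZ|apply: IH].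
Qed.

End Nullstellensatz.

(** * Finiteness of the branch locus *)

Section Points.
Variables (K : fieldType) (n : nat).
Implicit Types (P Q : proj K n) (v w : 'rV[K]_n.+1) (g h : {mpoly K[n.+1]}).

Lemma line_rep P : exists v, v != 0 /\ v \in line P.
Proof.
exists (vpick (line P)); rewrite memv_pick vpick0; split=> //.
by rewrite -dimv_eq0 (eqP (valP P)).
Qed.

Lemma line_span P v : v != 0 -> v \in line P -> line P = <[v]>%VS.
Proof.
move=> v0 vP; apply/esym/eqP.
by rewrite eqEdim -memvE vP dim_vline v0 (eqP (valP P)).
Qed.

Lemma line_inj P Q v : v != 0 -> v \in line P -> v \in line Q -> P = Q.
Proof.
move=> v0 vP vQ; apply: val_inj; change (line P = line Q).
by rewrite (line_span v0 vP) (line_span v0 vQ).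
Qed.

Lemma mp_evalD v g h : mp_eval (g + h) v = mp_eval g v + mp_eval h v.
Proof. exact: mevalD. Qed.

Lemma mp_evalM v g h : mp_eval (g * h) v = mp_eval g v * mp_eval h v.
Proof. exact: mevalM. Qed.

Lemma mp_evalZ v c g : mp_eval (c *: g) v = c * mp_eval g v.
Proof. exact: mevalZ. Qed.

Lemma mp_evalXn v g k : mp_eval (g ^+ k) v = mp_eval g v ^+ k.
Proof. exact: rmorphXn. Qed.

Lemma mp_eval_sum v (I : Type) (r : seq I) (p : pred I) (F : I -> {mpoly K[n.+1]}) :
  mp_eval (\sum_(i <- r | p i) F i) v = \sum_(i <- r | p i) mp_eval (F i) v.
Proof. exact: raddf_sum. Qed.

Lemma mp_evalU v i : mp_eval 'X_i v = v 0 i.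
Proof. exact: mevalXU. Qed.

Lemma mp_eval_scale v c d g : g \is d.-homog ->
  mp_eval g (c *: v) = c ^+ d * mp_eval g v.
Proof.
move/dhomogP => hg; rewrite (mpolyE g) !mp_eval_sum mulr_sumr big_seq [RHS]big_seq.
apply: eq_bigr => m /hg dm; rewrite !mp_evalZ mulrCA; congr (_ * _).
have -> : d = (\sum_i m i)%N by rewrite -mdegE.
rewrite /mp_eval !mevalX expr_sum -big_split.
by apply: eq_bigr => i _; rewrite mxE exprMn.
Qed.

Lemma vanishesP d g P v : g \is d.-homog -> v != 0 -> v \in line P ->
  vanishes g P <-> mp_eval g v = 0.
Proof.
move=> hg v0 vP; split=> [|g0 w]; first exact.
rewrite (line_span v0 vP) => /vlineP[c ->].
by rewrite (mp_eval_scale _ _ hg) g0 mulr0.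
Qed.

End Points.

(** * Closed sets, their ideals, and finiteness of proper closed subsets of a curve *)

Section Closed.
Variables (K : fieldType) (n : nat).
Implicit Types (X Y Z : proj K n -> Prop).

Definition ideal_of X d (g : {mpoly K[n.+1]}) :=
  g \is d.-homog /\ forall P, X P -> vanishes g P.

Lemma ideal_of_graded X : graded_ideal (ideal_of X).
Proof.
split=> [d g []//|d|d g h [hg g0] [hh h0]|d e a g ha [hg g0]].
- by split; [exact: dhomog0|move=> P _ v _; apply: meval0].
- split; first exact: dhomogD.
  by move=> P XP v vP; rewrite mp_evalD (g0 P) // (h0 P) // addr0.
- split; first exact: dhomogM.
  by move=> P XP v vP; rewrite mp_evalM (g0 P) // mulr0.
Qed.

Lemma closed_form d (g : {mpoly K[n.+1]}) : g \is d.-homog -> zariski_closed (vanishes g).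
Proof.
move=> hg; exists (fun h => h = g); split=> [h ->|P]; first by exists d.
by split=> [gP h ->|]; [|apply].
Qed.

Lemma closed_and Y Z : zariski_closed Y -> zariski_closed Z ->
  zariski_closed (fun P => Y P /\ Z P).
Proof.
move=> [S [hS YS]] [T [hT ZT]]; exists (fun g => S g \/ T g); split.
  by move=> g [/hS|/hT].
move=> P; split=> [[/YS SP /ZT TP] g [/SP|/TP] //|H].
by split; [apply/YS => g Sg|apply/ZT => g Tg]; apply: H; [left|right].
Qed.

Lemma closed_sub Y Z : zariski_closed Z -> gi_sub (ideal_of Z) (ideal_of Y) ->
  forall P, Y P -> Z P.
Proof.
move=> [S [hS ZS]] sub P YP; apply/ZS => g Sg.
have [d hg] := hS g Sg.
have [|_] := sub d g; last by apply.
by split=> // Q /ZS; apply.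
Qed.

Definition finite_pts Y := exists s : seq (proj K n), forall P, Y P -> P \in s.

Lemma irreducible_prime X : irreducible_closed X -> prime_gi (ideal_of X).
Proof.
case=> _ _ irrX d e a b ha hb [_ ab0].
have [P XP||] := irrX _ _ (closed_form ha) (closed_form hb).
- have [v [v0 vP]] := line_rep P.
  have /eqP := ab0 P XP v vP; rewrite mp_evalM mulf_eq0 => /orP[]/eqP.
    by rewrite -(vanishesP ha v0 vP); left.
  by rewrite -(vanishesP hb v0 vP); right.
- by left.
- by right.
Qed.

(** Among the infinite proper closed subsets of X take Z with maximal ideal, hence a minimal one.
    Every closed set not containing Z meets it in finitely many points, so Z is not covered by two
    such sets and is irreducible. Dimension one then makes it a point, a contradiction. *)
Lemma proper_closed_finite X Y : irreducible_closed X -> dimension_one X ->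
  zariski_closed Y -> (forall P, Y P -> X P) -> (exists P, X P /\ ~ Y P) -> finite_pts Y.
Proof.
move=> irrX [_ dimX] cY sYX ltYX; apply: NNPP => nfY.
pose C J := exists Z, [/\ J = ideal_of Z, zariski_closed Z, (forall P, Z P -> X P),
  (exists P, X P /\ ~ Z P) & ~ finite_pts Z].
have [||J [[Z [-> cZ sZX [Q [XQ nZQ]] nfZ]] maxZ]] := @gideal_maximal K n.+1 C.
- by move=> J [Z [-> _ _ _ _]]; apply: ideal_of_graded.
- by exists (ideal_of Y), Y; split.
have minZ W : zariski_closed W -> ~ (forall P, Z P -> W P) -> finite_pts (fun P => Z P /\ W P).
  move=> cW nsZW; apply: NNPP => nf; apply: nsZW => P ZP.
  have cZW := closed_and cZ cW.
  suff sub : gi_sub (ideal_of (fun P => Z P /\ W P)) (ideal_of Z).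
    by have [] := closed_sub cZW sub ZP.
  apply: maxZ; first by exists (fun P => Z P /\ W P); split=> //; [move=> R [/sZX]|exists Q; split=> // -[]].
  by move=> d g [hg g0]; split=> // R [/g0].
have irrZ : irreducible_closed Z.
  split=> //.
    by apply: NNPP => /not_ex_all_not noZ; apply: nfZ; exists [::] => P /noZ.
  move=> Y1 Y2 cY1 cY2 sub; apply: NNPP => /not_or_and[/(minZ _ cY1)[s1 Hs1] /(minZ _ cY2)[s2 Hs2]].
  apply: nfZ; exists (s1 ++ s2) => P ZP; rewrite mem_cat.
  by case: (sub P ZP) => YP; apply/orP; [left; apply: Hs1|right; apply: Hs2].
have [//||P HP] := dimX _ irrZ; first by exists Q.
by apply: nfZ; exists [:: P] => R /HP ->; rewrite inE.
Qed.

Lemma form_zeros_finite X d g : irreducible_closed X -> dimension_one X ->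
  g \is d.-homog -> ~ ideal_of X d g -> finite_pts (fun P => X P /\ vanishes g P).
Proof.
move=> irrX dimX hg ng; apply: (proper_closed_finite irrX dimX) => [|P []//|].
  by apply: closed_and (closed_form hg); case: irrX.
apply: NNPP => /not_ex_all_not H; apply: ng; split=> // P XP; apply: NNPP => nP.
by apply: (H P); split=> // -[].
Qed.

End Closed.

(** * Linear growth of the Hilbert function of a curve *)

Section Hilbert.
Variables (K : closedFieldType) (n : nat) (X : proj K n -> Prop).
Hypotheses (irrX : irreducible_closed X) (dimX : dimension_one X).
Local Notation S := {mpoly K[n.+1]}.
Local Notation I := (ideal_of X).

(** The form with coefficients 1, t, t^2, ... takes at a representative of P a value that is a
    nonzero polynomial in t; choose t outside the roots for all P in [s]. *)
Lemma linear_form_avoiding (s : seq (proj K n)) :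
  exists2 L : S, L \is 1.-homog & forall P, P \in s -> ~ vanishes L P.
Proof.
have [v Hv] := choice_fun (@line_rep K n).
pose q P := \poly_(i < n.+1) (v P 0 (inord i)).
have q0 P : q P != 0.
  have [/rV0Pn[i vi] _] := Hv P; apply/eqP => /polyP/(_ i)/eqP.
  by rewrite coef_poly ltn_ord inord_val coef0; apply/negP.
have : \prod_(P <- s) q P != 0 by rewrite prodf_seq_neq0; apply/allP => P _; rewrite q0.
case/closed_nonrootP => t; rewrite /root horner_prod prodf_seq_neq0 => /allP rt.
exists (\sum_(i < n.+1) t ^+ i *: 'X_i).
  by apply: rpred_sum => i _; apply/dhomogZ/dhomog_monomial; rewrite mdeg1.
move=> P /rt/eqP qt LP; apply: qt; have [_ vP] := Hv P.
rewrite -[RHS](LP _ vP) mp_eval_sum horner_poly.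
by apply: eq_bigr => i _; rewrite mp_evalZ mp_evalU inord_val mulrC.
Qed.

Lemma exists_coord : exists i, ~ I 1%N 'X_i.
Proof.
case: irrX => _ [P XP] _; have [v [/rV0Pn[i vi] vP]] := line_rep P.
by exists i => -[_ /(_ P XP v vP)/eqP]; rewrite mp_evalU; apply/negP.
Qed.

(** A homogeneous system of parameters: the coordinate [L0] has finitely many zeros on X and [L1]
    avoids them. As [L0] and [L1] have no common zero on X, the Nullstellensatz makes I + (L0, L1)
    full in some degree. *)
Lemma parameters : exists (L0 L1 : S) k, [/\ L0 \is 1.-homog, L1 \is 1.-homog &
  full (gi_adjoin (gi_adjoin I L0 1) L1 1) k].
Proof.
have [i0 ni0] := exists_coord.
have hL0 : 'X_i0 \is [in K[n.+1], 1.-homog] by apply: dhomog_monomial; rewrite mdeg1.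
have [s Hs] := form_zeros_finite irrX dimX hL0 ni0.
have [L1 hL1 nL1] := linear_form_avoiding s.
have gI := ideal_of_graded X; have gI0 := gi_adjoin_graded gI hL0.
exists 'X_i0, L1; apply: NNPP => /not_ex_all_not nk.
have [||v [v0 Hv]] := @nullstellensatz K n (gi_adjoin (gi_adjoin I 'X_i0 1) L1 1).
- exact: gi_adjoin_graded.
- by move=> k fk; apply: (nk k).
pose P := proj_of v0.
have vP : v \in line P by rewrite memv_line.
have IP d g : I d g -> mp_eval g v = 0 by move=> Ig; apply: (Hv d); do 2!apply: gi_adjoin_sub.
have L0P : mp_eval 'X_i0 v = 0 by apply: (Hv 1%N); apply/gi_adjoin_sub/gi_adjoin_mem.
have L1P : mp_eval L1 v = 0 by apply: (Hv 1%N); apply: gi_adjoin_mem.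
have XP : X P.
  case: (irrX) => -[T [hT XT]] _ _; apply/XT => g Tg; have [d hg] := hT g Tg.
  by apply/(vanishesP hg v0 vP)/(IP d); split=> // Q /XT; apply.
apply: (nL1 P); last exact/(vanishesP hL1 v0 vP).
by apply: Hs; split=> //; apply/(vanishesP hL0 v0 vP).
Qed.

(** Fullness in degree k allows one factor [L0] or [L1] to be split off at a time, modulo I, as long
    as the degree exceeds k. *)
Lemma expand_parameters (L0 L1 : S) k m (g : S) :
  L0 \is 1.-homog -> L1 \is 1.-homog ->
  full (gi_adjoin (gi_adjoin I L0 1) L1 1) k -> g \is (m + k).-homog ->
  exists u : nat -> S, (forall a, u a \is k.-homog) /\
    I (m + k)%N (g - \sum_(a < m.+1) L0 ^+ a * L1 ^+ (m - a) * u a).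
Proof.
move=> hL0 hL1 fk; have gI := ideal_of_graded X; have gI0 := gi_adjoin_graded gI hL0.
have gI1 := gi_adjoin_graded gI0 hL1.
elim: m g => [|m IH] g hg.
  exists (fun _ => g); split=> // ; rewrite big_ord_recl big_ord0 addr0 !mul1r subrr.
  exact: gi_0.
have /gi_adjoinS[_ [b1 [/gi_adjoinS[j [b0 [Ij hb0 ->]]] hb1 ->]]] :
    gi_adjoin (gi_adjoin I L0 1) L1 1 (m + k).+1 g.
  by rewrite -addSn addnC; apply: (full_up _ fk); rewrite // addnC.
have [u0 [hu0 Iu0]] := IH _ hb0; have [u1 [hu1 Iu1]] := IH _ hb1.
exists (fun a => (if a is a'.+1 then u0 a' else 0) + (if (a <= m)%N then u1 a else 0)).
split=> [a|].
  by apply: dhomogD; [case: a => [|a]|case: ifP => _]; rewrite ?dhomog0.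
under eq_bigr do rewrite mulrDr.
rewrite big_split /= big_ord_recl mulr0 add0r [X in _ - (_ + X)]big_ord_recr /= ltnn mulr0 addr0.
have -> : \sum_(i < m.+1) L0 ^+ bump 0 i * L1 ^+ (m.+1 - bump 0 i) * u0 i =
    L0 * \sum_(a < m.+1) L0 ^+ a * L1 ^+ (m - a) * u0 a.
  by rewrite mulr_sumr; apply: eq_bigr => i _; rewrite subSS exprS !mulrA.
have -> : \sum_(i < m.+1) L0 ^+ i * L1 ^+ (m.+1 - i) * (if (i <= m)%N then u1 i else 0) =
    L1 * \sum_(a < m.+1) L0 ^+ a * L1 ^+ (m - a) * u1 a.
  rewrite mulr_sumr; apply: eq_bigr => i _; rewrite -ltnS ltn_ord subSn -1?ltnS // exprS.
  by rewrite [RHS]mulrA [L1 * (_ * _)]mulrCA.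
set s0 := \sum_(a < _) _ in Iu0 *; set s1 := \sum_(a < _) _ in Iu1 *.
have -> : j + b0 * L0 + b1 * L1 - (L0 * s0 + L1 * s1) = j + L0 * (b0 - s0) + L1 * (b1 - s1).
  by ring.
apply: gi_add => //; last exact: (gi_mul _ (e := 1)).
by apply: gi_add => //; apply: (gi_mul _ (e := 1)).
Qed.

Lemma hilbert_linear : exists k D, forall (J : finType) m (F : J -> S),
  (forall i, F i \is (m + k).-homog) -> (m.+1 * D < #|J|)%N ->
  exists c : J -> K, (exists i, c i != 0) /\ I (m + k)%N (\sum_i c i *: F i).
Proof.
have [L0 [L1 [k [hL0 hL1 fk]]]] := parameters.
pose T : finType := 'X_{1..n.+1 < k.+1}.
exists k, #|T| => J m F hF ltJ; have gI := ideal_of_graded X.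
have [u Hu] := choice_fun (fun i => expand_parameters hL0 hL1 fk (hF i)).
have [|c [c0 Hc]] := @linear_dependence K J ('I_m.+1 * T)%type (fun i x => (u i x.1)@_x.2).
  by rewrite card_prod card_ord.
exists c; split=> //.
have cu0 (a : 'I_m.+1) : \sum_i c i *: u i a = 0.
  apply: (@dhomog_coord_inj _ _ k).
    by apply: rpred_sum => i _; apply: dhomogZ; have [] := Hu i.
  move=> t; rewrite raddf_sum /= -[RHS](Hc (a, t)).
  by apply: eq_bigr => i _; rewrite mcoeffZ.
have -> : \sum_i c i *: F i =
   \sum_i c i *: (F i - \sum_(a < m.+1) L0 ^+ a * L1 ^+ (m - a) * u i a).
  under [RHS]eq_bigr do rewrite scalerBr scaler_sumr.
  rewrite sumrB exchange_big /= [X in _ - X]big1 ?subr0 // => a _.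
  under eq_bigr do rewrite scalerAr.
  by rewrite -mulr_sumr cu0 mulr0.
by apply: gi_sum => // i _; apply: gi_scale => //; have [] := Hu i.
Qed.

End Hilbert.

(** * Differentials of forms and of homogenized polynomials *)

Section Differentials.
Variables (K : fieldType) (n : nat) (v w : 'rV[K]_n.+1).
Implicit Types (a b g h : {mpoly K[n.+1]}).

Lemma mp_diffD g h : mp_diff (g + h) v w = mp_diff g v w + mp_diff h v w.
Proof.
rewrite /mp_diff -big_split; apply: eq_bigr => i _.
by rewrite mderivD mp_evalD mulrDl.
Qed.

Lemma mp_diffZ c g : mp_diff (c *: g) v w = c * mp_diff g v w.
Proof.
rewrite /mp_diff mulr_sumr; apply: eq_bigr => i _.
by rewrite mderivZ mp_evalZ mulrA.
Qed.

Lemma mp_diff0 : mp_diff 0 v w = 0.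
Proof. by rewrite -(scale0r (0 : {mpoly K[n.+1]})) mp_diffZ mul0r. Qed.

Lemma mp_diff_sum (I : Type) (r : seq I) (P : pred I) (F : I -> {mpoly K[n.+1]}) :
  mp_diff (\sum_(i <- r | P i) F i) v w = \sum_(i <- r | P i) mp_diff (F i) v w.
Proof. by apply: (big_morph (fun g => mp_diff g v w)); [apply: mp_diffD|apply: mp_diff0]. Qed.

Lemma mp_diffM g h :
  mp_diff (g * h) v w = mp_diff g v w * mp_eval h v + mp_eval g v * mp_diff h v w.
Proof.
rewrite /mp_diff mulr_suml mulr_sumr -big_split; apply: eq_bigr => i _ /=.
by rewrite mderivM mp_evalD !mp_evalM; ring.
Qed.

Lemma mp_diff1 : mp_diff 1 v w = 0.
Proof.
rewrite /mp_diff big1 // => i _.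
by rewrite -[1]/(1%:MP) mderivC /mp_eval meval0 mul0r.
Qed.

Lemma mp_diffU i : mp_diff 'X_i v w = w 0 i.
Proof.
rewrite /mp_diff (bigD1 i) //= big1 ?addr0 => [|j ji]; rewrite mderivX mp_evalZ mnm1E.
  rewrite eqxx mul1r -{1}[U_(i)%MM]add0m addmK mpolyX0 /mp_eval meval1 mul1r //.
by rewrite eq_sym (negPf ji) !mul0r.
Qed.

(* The logarithmic derivative of [b] is [mu] and the derivative of [a / b] is [eps]. *)
Variables (a b : {mpoly K[n.+1]}) (x mu eps : K).
Hypotheses (Ea : mp_eval a v = x * mp_eval b v)
  (Db : mp_diff b v w = mu * mp_eval b v)
  (Da : mp_diff a v w = mu * mp_eval a v + eps * mp_eval b v).

Lemma mp_diff_expb k : mp_diff (b ^+ k) v w = k%:R * mu * mp_eval b v ^+ k.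
Proof.
elim: k => [|k IH]; first by rewrite mp_diff1 !mul0r.
by rewrite exprS mp_diffM IH Db mp_evalXn exprS -natr1; ring.
Qed.

Lemma mp_diff_expa k : mp_diff (a ^+ k) v w =
  (k%:R * mu * x ^+ k + eps * ('X^k)^`().[x]) * mp_eval b v ^+ k.
Proof.
elim: k => [|k IH]; first by rewrite mp_diff1 expr0 derivC horner0; ring.
have -> : 'X^(k.+1)^`().[x] = x ^+ k + x * ('X^k)^`().[x].
  by rewrite exprS derivM derivX mul1r hornerD hornerM hornerX hornerXn.
by rewrite exprS mp_diffM IH Da mp_evalXn Ea exprMn !exprS -natr1; ring.
Qed.

Lemma mp_eval_hpoly N (p : {poly K}) : (size p <= N.+1)%N ->
  mp_eval (hpoly N p a b) v = mp_eval b v ^+ N * p.[x].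
Proof.
move=> sp; rewrite /hpoly mp_eval_sum (horner_coef_wide _ sp) mulr_sumr.
apply: eq_bigr => i _; rewrite mp_evalZ mp_evalM !mp_evalXn Ea exprMn.
have EN : mp_eval b v ^+ N = mp_eval b v ^+ i * mp_eval b v ^+ (N - i).
  by rewrite -exprD subnKC // -ltnS.
by rewrite EN; ring.
Qed.

(** The product rule for b^N p(a/b): the first factor contributes [N%:R * mu], the second [eps]
    times the derivative of p at x = a/b. *)
Lemma mp_diff_hpoly N (p : {poly K}) : (size p <= N.+1)%N ->
  mp_diff (hpoly N p a b) v w = mp_eval b v ^+ N * (N%:R * mu * p.[x] + eps * p^`().[x]).
Proof.
move=> sp; rewrite /hpoly mp_diff_sum.
have -> : p^`() = \sum_(i < N.+1) p`_i *: ('X^i)^`().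
  rewrite -{1}(coefK p) poly_def raddf_sum /=.
  rewrite (big_ord_widen _ (fun i => (p`_i *: 'X^i)^`()) sp) big_mkcond /=.
  by apply: eq_bigr => i _; rewrite -derivZ; case: ltnP => // /(nth_default 0) ->; rewrite scale0r raddf0.
rewrite (horner_coef_wide _ sp) horner_sum !mulr_sumr -big_split mulr_sumr /=.
apply: eq_bigr => i _; rewrite mp_diffZ mp_diffM mp_diff_expa mp_diff_expb !mp_evalXn hornerZ Ea exprMn.
have lei : (i <= N)%N by rewrite -ltnS.
have EN : mp_eval b v ^+ N = mp_eval b v ^+ i * mp_eval b v ^+ (N - i) by rewrite -exprD subnKC.
rewrite EN natrB //; ring.
Qed.

End Differentials.

(** * Forms obtained from polynomials in two quotients of forms *)

Section Bihomogeneous.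
Variables (K : fieldType) (n : nat).
Implicit Types (a b c e : {mpoly K[n.+1]}) (F : {poly {poly K}}).

(* The homogenization of F(a / b, c / e), of degree N in (a, b) and N' in (c, e). *)
Definition bipoly N N' F a b c e : {mpoly K[n.+1]} :=
  \sum_(j < N'.+1) hpoly N F`_j a b * (c ^+ j * e ^+ (N' - j)).

Lemma bipoly_homog N N' F d a b c e : a \is d.-homog -> b \is d.-homog ->
  c \is 1.-homog -> e \is 1.-homog -> bipoly N N' F a b c e \is (d * N + N').-homog.
Proof.
move=> ha hb hc he; apply: rpred_sum => j _; apply: dhomogM; first exact: hpoly_homog.
by have := dhomogM (dhomogMn j hc) (dhomogMn (N' - j) he); rewrite !mul1n subnKC // -ltnS.
Qed.

Variables (N N' : nat) (F : {poly {poly K}}).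
Hypotheses (sF : (size F <= N'.+1)%N) (sFj : forall j, (size (F`_j)%R <= N.+1)%N).

Variables (v : 'rV[K]_n.+1) (a b c e : {mpoly K[n.+1]}) (x y : K).
Hypotheses (Ea : mp_eval a v = x * mp_eval b v) (Ec : mp_eval c v = y * mp_eval e v).

Lemma mp_eval_bipoly :
  mp_eval (bipoly N N' F a b c e) v = mp_eval b v ^+ N * mp_eval e v ^+ N' * F.[y%:P].[x].
Proof.
rewrite /bipoly mp_eval_sum (horner_coef_wide _ sF) horner_sum mulr_sumr.
apply: eq_bigr => j _; rewrite mp_evalM mp_evalM (mp_eval_hpoly Ea) // !mp_evalXn Ec.
have EN : mp_eval e v ^+ N' = mp_eval e v ^+ j * mp_eval e v ^+ (N' - j).
  by rewrite -exprD subnKC // -ltnS.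
by rewrite EN exprMn hornerM horner_exp hornerC; ring.
Qed.

(** The common logarithmic derivative [la] says that a/b is stationary along [w]. So, apart from the
    homogenizing factors, only the derivative of F in its outer variable, that of c/e,
    contributes. *)
Lemma mp_diff_bipoly w la mu eps :
  mp_diff a v w = la * mp_eval a v -> mp_diff b v w = la * mp_eval b v ->
  mp_diff e v w = mu * mp_eval e v ->
  mp_diff c v w = mu * mp_eval c v + eps * mp_eval e v ->
  mp_diff (bipoly N N' F a b c e) v w = mp_eval b v ^+ N * mp_eval e v ^+ N' *
    ((N%:R * la + N'%:R * mu) * F.[y%:P].[x] + eps * F^`().[y%:P].[x]).
Proof.
move=> Da Db De Dc; rewrite /bipoly mp_diff_sum.
have Da' : mp_diff a v w = la * mp_eval a v + 0 * mp_eval b v by rewrite Da mul0r addr0.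
have -> : F^`() = \sum_(i < N'.+1) F`_i *: ('X^i)^`().
  rewrite -{1}(coefK F) poly_def raddf_sum /=.
  rewrite (big_ord_widen _ (fun i => (F`_i *: 'X^i)^`()) sF) big_mkcond /=.
  by apply: eq_bigr => i _; rewrite -derivZ; case: ltnP => // /(nth_default 0) ->; rewrite scale0r raddf0.
rewrite (horner_coef_wide _ sF) !horner_sum !mulr_sumr -big_split mulr_sumr /=.
apply: eq_bigr => j _.
rewrite mp_diffM mp_diffM (mp_diff_hpoly Ea Db Da') // (mp_eval_hpoly Ea) // (mp_diff_expa Ec Dc).
rewrite (mp_diff_expb De) mp_evalM !mp_evalXn Ec exprMn hornerZ !hornerM horner_exp hornerC.
have -> : ('X^j)^`().[y%:P] = (('X^j)^`().[y])%:P :> {poly K}.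
  by rewrite !derivXn !hornerMn !hornerXn -rmorphXn -rmorphMn.
have lej : (j <= N')%N by rewrite -ltnS.
have EN : mp_eval e v ^+ N' = mp_eval e v ^+ j * mp_eval e v ^+ (N' - j) by rewrite -exprD subnKC.
by rewrite EN natrB // hornerC; ring.
Qed.

End Bihomogeneous.

(** * The affine coordinate on the projective line *)

Section ProjectiveLine.
Variable K : fieldType.
Implicit Types (u : 'rV[K]_2) (q : proj K 1).

Lemma vec2_0 (x y : K) : vec2 x y 0 0 = x. Proof. by rewrite mxE. Qed.
Lemma vec2_1 (x y : K) : vec2 x y 0 1 = y. Proof. by rewrite mxE. Qed.

Lemma row2_eq u u' : u 0 0 = u' 0 0 -> u 0 1 = u' 0 1 -> u = u'.
Proof.
move=> E0 E1; apply/rowP => i.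
have [->|->] // : i = 0 \/ i = 1.
by case: i => -[|[|//]] lti; [left|right]; apply: val_inj.
Qed.

Lemma mem_affine x u : u \in line (affine_pt x) <-> u 0 0 = x * u 0 1.
Proof.
split=> [/vlineP[c ->]|E]; first by rewrite !mxE /= mulr1 mulrC.
by apply/vlineP; exists (u 0 1); apply: row2_eq; rewrite !mxE /= ?mulr1 // E mulrC.
Qed.

Lemma mem_infty u : u \in line (infty_pt K) <-> u 0 1 = 0.
Proof.
split=> [/vlineP[c ->]|E]; first by rewrite !mxE /= mulr0.
by apply/vlineP; exists (u 0 0); apply: row2_eq; rewrite !mxE /= ?mulr1 // E mulr0.
Qed.

(** At infinity the denominator is 0, so the value there is 0 by the convention for division. *)
Definition affine_coord q : K := let u := vpick (line q) in u 0 0 / u 0 1.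

Lemma affine_ptP q u : u \in line q -> u 0 1 != 0 -> q = affine_pt (u 0 0 / u 0 1).
Proof.
move=> uq u1; apply: (@line_inj _ _ _ _ u) => //.
  by apply: contraNneq u1 => ->; rewrite mxE.
by apply/mem_affine; rewrite divfK.
Qed.

Lemma infty_ptP q u : u != 0 -> u \in line q -> u 0 1 = 0 -> q = infty_pt K.
Proof. by move=> u0 uq u1; apply: (line_inj u0 uq); apply/mem_infty. Qed.

Lemma affine_ptK : cancel (@affine_pt K) affine_coord.
Proof.
move=> x; rewrite /affine_coord; set u := vpick _.
have ux : u \in line (affine_pt x) by apply: memv_pick.
have u0 : u != 0 by rewrite vpick0 -dimv_eq0 (eqP (valP (affine_pt x))).
move/mem_affine: ux => E; have u1 : u 0 1 != 0.
  by apply: contraNneq u0 => u1; apply/eqP/row2_eq; rewrite ?E u1 mxE ?mulr0.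
by rewrite E mulfK.
Qed.

Lemma affine_neq_infty x : affine_pt x != infty_pt K.
Proof.
apply/eqP => E; have: vec2 x 1 \in line (infty_pt K) by rewrite -E memv_line.
by move/mem_infty/eqP; rewrite vec2_1 oner_eq0.
Qed.

Lemma affine_coordK q : q != infty_pt K -> affine_pt (affine_coord q) = q.
Proof.
have [u [u0 uq]] := line_rep q => nq.
have u1 : u 0 1 != 0 by apply: contraNneq nq => /(infty_ptP u0 uq) ->.
by rewrite (affine_ptP uq u1) affine_ptK.
Qed.

End ProjectiveLine.

Lemma deriv_eq0 (K : numDomainType) (F : {poly {poly K}}) : F^`() = 0 -> F = (F`_0)%:P.
Proof.
move=> F'0; apply/polyP => -[|i]; rewrite coefC //=; apply/polyP => j.
move/polyP/(_ i)/polyP/(_ j): F'0; rewrite coef_deriv coefMn !coef0.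
by move/eqP; rewrite mulrn_eq0 => /eqP.
Qed.

(** * A function of positive degree has finitely many branch points *)

Section Ramification.
Variables (K : numClosedFieldType) (n : nat) (X : proj K n -> Prop).
Hypotheses (irrX : irreducible_closed X) (dimX : dimension_one X).
Local Notation S := {mpoly K[n.+1]}.
Local Notation I := (ideal_of X).

Section Relation.
Variables (d : nat) (a b : S) (i0 i : 'I_n.+1).
Hypotheses (ha : a \is d.-homog) (hb : b \is d.-homog).

(** The outer variable of F stands for x_i / x_i0 and the inner one for a/b. *)
Definition relation (F : {poly {poly K}}) := forall P v, X P -> v \in line P ->
  mp_eval b v != 0 -> v 0 i0 != 0 ->
  F.[(v 0 i / v 0 i0)%:P].[mp_eval a v / mp_eval b v] = 0.

Let hX j : 'X_j \is [in K[n.+1], 1.-homog].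
Proof. by apply: dhomog_monomial; rewrite mdeg1. Qed.

Let mp_eval_bi N N' (F : {poly {poly K}}) v : (size F <= N'.+1)%N -> (forall j, (size (F`_j)%R <= N.+1)%N) ->
  mp_eval b v != 0 -> v 0 i0 != 0 ->
  mp_eval (bipoly N N' F a b 'X_i 'X_i0) v = mp_eval b v ^+ N * v 0 i0 ^+ N' *
    F.[(v 0 i / v 0 i0)%:P].[mp_eval a v / mp_eval b v].
Proof.
move=> sF sFj b0 v0; rewrite -{1}(mp_evalU v i0); apply: mp_eval_bipoly => //.
  by rewrite divfK.
by rewrite !mp_evalU divfK.
Qed.

Lemma relation_exists : exists F, F != 0 /\ relation F.
Proof.
have [k [D HD]] := hilbert_linear irrX dimX.
(* There are (s + 1)^2 products [F x], all of degree ds + s, while the Hilbert bound grows linearly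
   in s. This s is large enough for the count, and s >= k makes the subtraction in [m] exact. *)
pose s := (D * d.+1 + k)%N; pose m := (d * s + s - k)%N.
have Em : (m + k = d * s + s)%N by rewrite /m /s; nia.
pose F (x : 'I_s.+1 * 'I_s.+1) : S :=
  a ^+ x.1 * b ^+ (s - x.1) * ('X_i ^+ x.2 * 'X_i0 ^+ (s - x.2)).
have hF x : F x \is (m + k).-homog.
  rewrite Em; have := dhomogM (dhomogM (dhomogMn x.1 ha) (dhomogMn (s - x.1) hb))
    (dhomogM (dhomogMn x.2 (hX i)) (dhomogMn (s - x.2) (hX i0))).
  by rewrite -!mulnDr mul1n !subnKC -1?ltnS.
have [|c [[[p q] cpq] Ic]] := HD _ m F hF.
  rewrite card_prod card_ord /m /s; nia.
pose G : {poly {poly K}} :=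
  \poly_(y < s.+1) \poly_(x < s.+1) c (inord x, inord y).
exists G; split.
  apply/eqP => /polyP/(_ q)/polyP/(_ p); rewrite !coef0 !coef_poly !ltn_ord coef_poly ltn_ord !inord_val.
  by apply/eqP.
have E : bipoly s s G a b 'X_i 'X_i0 = \sum_x c x *: F x.
  transitivity (\sum_y \sum_x c (x, y) *: F (x, y)); last first.
    by rewrite exchange_big pair_bigA; apply: eq_bigr => -[].
  apply: eq_bigr => y _; rewrite /hpoly mulr_suml; apply: eq_bigr => x _.
  by rewrite -scalerAl !coef_poly !ltn_ord coef_poly ltn_ord !inord_val.
move=> P v XP vP b0 v0; case: Ic => _ /(_ P XP v vP); rewrite -E mp_eval_bi //.
- by move/eqP; rewrite !mulf_eq0 !expf_eq0 (negPf b0) (negPf v0) !andbF => /eqP.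
- exact: size_poly.
- by move=> j; rewrite coef_poly; case: ifP => _; rewrite ?size_poly0 ?size_poly.
Qed.

Hypothesis infinite_values : forall p : {poly K}, p != 0 ->
  exists P v, [/\ X P, v \in line P, mp_eval b v != 0, v 0 i0 != 0
    & p.[mp_eval a v / mp_eval b v] != 0].

(** A nonzero relation is replaced by its derivative while that is again a nonzero relation. The
    derivative cannot reach 0: in characteristic 0 the relation would then be a nonzero polynomial
    in a/b alone, and a/b takes values outside its roots. *)
Lemma minimal_relation : exists F, relation F /\ ~ relation F^`().
Proof.
have [F [F0 relF]] := relation_exists.
have [N] := ubnP (size F); elim: N => // N IH in F F0 relF *; rewrite ltnS => sF.
case: (classic (relation F^`())) => [relF'|]; last by exists F.
have [F'0|F'0] := eqVneq F^`() 0; last first.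
  by apply: (IH F^`()) => //; apply: leq_trans (lt_size_deriv F0) sF.
have EF := deriv_eq0 F'0.
have [|P [v [XP vP b0 v0]]] := infinite_values (p := F`_0).
  by apply: contraNneq F0 => E; rewrite EF E.
by rewrite -[F`_0](hornerC _ (v 0 i / v 0 i0)%:P) -EF (relF P v) ?eqxx.
Qed.

Hypotheses (nb : ~ I d b) (n0 : ~ I 1%N 'X_i0).

(* Where [g] does not vanish, a tangent vector killed by the differential of
   a / b is killed by that of 'X_i / 'X_i0. *)
Lemma coordinate_differential : exists e g, [/\ g \is e.-homog, ~ I e g &
  forall P v w la, X P -> v \in line P -> mp_eval b v != 0 -> v 0 i0 != 0 ->
    mp_eval g v != 0 -> cone_tangent X P w ->
    mp_diff a v w = la * mp_eval a v -> mp_diff b v w = la * mp_eval b v ->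
    w 0 i = w 0 i0 / v 0 i0 * v 0 i].
Proof.
have [F [relF nrelF']] := minimal_relation.
pose N' := size F; pose N := (\max_(j < size F) size (F`_j)%R)%N.
have sF : (size F <= N'.+1)%N by [].
have sFj j : (size (F`_j)%R <= N.+1)%N.
  case: (ltnP j (size F)) => [ltj|/(nth_default 0) ->]; last by rewrite size_poly0.
  exact/leqW/(leq_bigmax (Ordinal ltj)).
have sF' : (size F^`() <= N'.+1)%N by apply: leq_trans (size_poly _ _) _; rewrite /N'; lia.
have sFj' j : (size (F^`()`_j)%R <= N.+1)%N.
  rewrite coef_deriv; apply: leq_trans (sFj j.+1).
  by rewrite -scaler_nat size_scale_leq.
pose G := bipoly N N' F a b 'X_i 'X_i0; pose g := bipoly N N' F^`() a b 'X_i 'X_i0.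
have hG : G \is (d * N + N').-homog by apply: bipoly_homog.
have hg : g \is (d * N + N').-homog by apply: bipoly_homog.
(* [b * 'X_i0 * G] vanishes on all of X, also where the relation says nothing; primality of I
   removes the two factors. *)
have IG : I (d * N + N')%N G.
  have gI := ideal_of_graded X; have prI := irreducible_prime irrX.
  have Ip : I (d + (1 + (d * N + N')))%N (b * ('X_i0 * G)).
    split=> [|P XP v vP]; first by do 2?apply: dhomogM.
    rewrite !mp_evalM mp_evalU.
    have [->|b0] := eqVneq (mp_eval b v) 0; first by rewrite mul0r.
    have [->|v0] := eqVneq (v 0 i0) 0; first by rewrite mul0r mulr0.
    by rewrite mp_eval_bi // (relF P v) // !mulr0.
  case: (prI _ _ _ _ hb (dhomogM (hX i0) hG) Ip) => [//|].
  by case/(prI _ _ _ _ (hX i0) hG).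
exists (d * N + N')%N, g; split=> //.
  case=> _ g0; apply: nrelF' => P v XP vP b0 v0.
  have /eqP := g0 P XP v vP; rewrite mp_eval_bi //.
  by rewrite !mulf_eq0 !expf_eq0 (negPf b0) (negPf v0) !andbF => /eqP.
move=> P v w la XP vP b0 v0 gv Tw Da Db.
(* [mu] is the logarithmic derivative of ['X_i0] along [w] and [eps] the derivative of x_i / x_i0.
   As G is in I, its differential kills [w], which reads [eps] times a nonzero multiple of g(v)
   equals 0. *)
pose mu := w 0 i0 / v 0 i0; pose eps := (w 0 i - mu * v 0 i) / v 0 i0.
have := Tw _ _ hG (proj2 IG) v vP.
rewrite (@mp_diff_bipoly _ _ N N' F sF sFj v a b 'X_i 'X_i0
  (mp_eval a v / mp_eval b v) (v 0 i / v 0 i0) _ _ w la mu eps) //.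
- rewrite (relF P v) // mulr0 add0r => /eqP.
  move: gv; rewrite mp_eval_bi // mulf_eq0 negb_or => /andP[bv gv].
  rewrite mp_evalU mulf_eq0 (negPf bv) mulf_eq0 (negPf gv) orbF /= /eps mulf_eq0 invr_eq0.
  by rewrite (negPf v0) orbF subr_eq0 => /eqP.
- by rewrite divfK.
- by rewrite !mp_evalU divfK.
- by rewrite mp_evalU mp_diffU /mu divfK.
- by rewrite !mp_evalU mp_diffU /eps divfK // addrC subrK.
Qed.

End Relation.

(** Represent f by forms (a, b) with b not identically 0 on X. Off the finitely many zeros of b, of
    ['X_i0] and of the forms from [coordinate_differential], a tangent vector killed by df is a
    multiple of v, so f is unramified. The images of the excluded points form [s]. *)
Lemma finite_branch_locus f d : meromorphic X f -> has_degree X f d -> (0 < d)%N ->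
  exists s : seq K, forall x, x \notin s -> unbranched_at X f (affine_pt x).
Proof.
case=> morf [P0 [XP0 fP0]] [B HB] d_gt0.
have [e [A [[hA repA] [v0 vP0 Av0]]]] := morf P0 XP0.
pose a := A 0; pose b := A 1.
have fpt P v : X P -> v \in line P -> mp_eval b v != 0 ->
    line (f P) = <[forms_eval A v]>%VS /\ f P = affine_pt (mp_eval a v / mp_eval b v).
  move=> XP vP bv; have E : line (f P) = <[forms_eval A v]>%VS.
    by apply: repA => //; apply: contraNneq bv => /rowP/(_ 1); rewrite !mxE => ->.
  split=> //; have := @affine_ptP _ (f P) (forms_eval A v); rewrite !mxE; apply=> //.
  by rewrite E memv_line.
have nIb : ~ I e b.
  case=> _ /(_ P0 XP0 v0 vP0) bv0; apply: fP0; apply: (infty_ptP Av0); last by rewrite mxE.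
  by rewrite (repA P0 v0) // memv_line.
have [i0 ni0] := exists_coord irrX.
have hX : 'X_i0 \is [in K[n.+1], 1.-homog] by apply: dhomog_monomial; rewrite mdeg1.
have [sb Hsb] := form_zeros_finite irrX dimX (hA 1) nIb.
have [s0 Hs0] := form_zeros_finite irrX dimX hX ni0.
have good P v : X P -> P \notin sb ++ s0 -> v \in line P -> v != 0 ->
    mp_eval b v != 0 /\ v 0 i0 != 0.
  move=> XP; rewrite mem_cat negb_or => /andP[Pb P0'] vP v_neq0; split.
    by apply: contraNneq Pb => /(vanishesP (hA 1) v_neq0 vP) ?; apply: Hsb.
  apply: contraNneq P0' => E; apply: Hs0; split=> //.
  by apply/(vanishesP hX v_neq0 vP); rewrite mp_evalU.
(* Positive degree gives a preimage to all but finitely many points of the line, so x can be taken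
   off the roots of [p], off [B] and off the images of the bad points. *)
have infv (p : {poly K}) : p != 0 -> exists P v, [/\ X P, v \in line P,
    mp_eval b v != 0, v 0 i0 != 0 & p.[mp_eval a v / mp_eval b v] != 0].
  move=> p0; pose t := map (@affine_coord K) (B ++ map f (sb ++ s0)).
  have: p * \prod_(c <- t) ('X - c%:P) != 0.
    by rewrite mulf_neq0 // monic_neq0 // monic_prod_XsubC.
  case/closed_nonrootP => x; rewrite rootM negb_or root_prod_XsubC => /andP[px xt].
  have nt q : q \in B ++ map f (sb ++ s0) -> q <> affine_pt x.
    by move=> qt E; apply/negP: xt; apply/negPn; rewrite -(affine_ptK x) -E map_f.
  have [|[|P r] [_ Er Hr]] := HB (affine_pt x).
  - by apply/negP => xB; apply: (nt (affine_pt x)); rewrite // mem_cat xB.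
  - by rewrite -Er in d_gt0.
  have [XP fP] : X P /\ f P = affine_pt x by apply/Hr; rewrite mem_head.
  have [v [v_neq0 vP]] := line_rep P.
  have Ps : P \notin sb ++ s0.
    by apply/negP => Ps; apply: (nt (f P)); rewrite // mem_cat map_f ?orbT.
  have [bv vi0] := good P v XP Ps vP v_neq0.
  exists P, v; split=> //; have [_] := fpt P v XP vP bv; rewrite fP => /(can_inj (@affine_ptK K)) <-.
  exact: px.
have Hg i := coordinate_differential i (hA 0) (hA 1) infv nIb ni0.
have {Hg} [g Hg] := choice_fun Hg; have [h Hh] := choice_fun Hg.
have zg i : finite_pts (fun P => X P /\ vanishes (h i) P).
  by have [hh nIh _] := Hh i; apply: form_zeros_finite hh nIh.
have [z Hz] := choice_fun zg.
pose E := sb ++ s0 ++ flatten [seq z i | i <- enum 'I_n.+1].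
exists (map (fun P => affine_coord (f P)) E) => x xE P XP fP.
have PE : P \notin E by apply: contra xE => PE; rewrite -(affine_ptK x) -fP; apply: (map_f (fun P => affine_coord (f P))).
have [v [v_neq0 vP]] := line_rep P.
move: PE; rewrite /E catA mem_cat negb_or => /andP[Pbs Pz].
have [bv vi0] := good P v XP Pbs vP v_neq0.
have hv i : mp_eval (h i) v != 0.
  have [hh _ _] := Hh i; apply: contraNneq Pz => /(vanishesP hh v_neq0 vP) hP.
  apply/flattenP; exists (z i); first by apply: map_f; rewrite mem_enum.
  by apply: Hz.
exists e, A, v; split=> //; first by apply: contraNneq bv => /rowP/(_ 1); rewrite !mxE => ->.
have [-> _] := fpt P v XP vP bv.
move=> w Tw /vlineP[la Ela].
have Da : mp_diff a v w = la * mp_eval a v by move/rowP/(_ 0): Ela; rewrite !mxE.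
have Db : mp_diff b v w = la * mp_eval b v by move/rowP/(_ 1): Ela; rewrite !mxE.
rewrite (line_span v_neq0 vP); apply/vlineP; exists (w 0 i0 / v 0 i0).
by apply/rowP => i; rewrite mxE; have [_ _ Hi] := Hh i; apply: (Hi P v w la).
Qed.

End Ramification.

(** * Composition with rational self-maps of the projective line *)

Lemma flatten_fibres (A B : eqType) (S : A -> seq B) (h : B -> A) (d : nat) (s : seq A) :
  uniq s -> (forall z, z \in s -> [/\ uniq (S z), size (S z) = d & {in S z, forall P, h P = z}]) ->
  uniq (flatten (map S s)) /\ size (flatten (map S s)) = (size s * d)%N.
Proof.
elim: s => [|z s IH] //= /andP[zs us] HS.
have [uz sz hz] := HS z (mem_head _ _).
have [uf sf] := IH us (fun y ys => HS y (mem_behead (s := z :: s) ys)).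
rewrite cat_uniq size_cat sz sf mulSn uz uf andbT; split=> //; apply/hasPn => P.
case/flattenP => _ /mapP[y ys ->] PSy; apply: contra zs => PSz.
by have [_ _ hy] := HS y (mem_behead (s := z :: s) ys); rewrite -(hz P PSz) (hy P PSy).
Qed.

Section Composition.
Variables (K : numClosedFieldType) (p q : {poly K}).
Let e := (maxn (size p) (size q)).-1.
Hypotheses (cpq : coprimep p q) (e_gt0 : (0 < e)%N).
Implicit Types (r : {poly K}) (u : 'rV[K]_2) (P : proj K 1).

Let sp : (size p <= e.+1)%N. Proof. by rewrite /e; lia. Qed.
Let sq : (size q <= e.+1)%N. Proof. by rewrite /e; lia. Qed.

(** The value at [u] of the homogenization of [r] in degree [e], the degree of the rational map
    p/q. *)
Definition hval (r : {poly K}) u : K := \sum_(i < e.+1) r`_i * (u 0 0 ^+ i * u 0 1 ^+ (e - i)).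

Lemma hval_affine r u : (size r <= e.+1)%N -> u 0 1 != 0 ->
  hval r u = u 0 1 ^+ e * r.[u 0 0 / u 0 1].
Proof.
move=> sr u1; rewrite (horner_coef_wide _ sr) mulr_sumr; apply: eq_bigr => i _.
have -> : u 0 1 ^+ e = u 0 1 ^+ i * u 0 1 ^+ (e - i) by rewrite -exprD subnKC // -ltnS.
have -> : u 0 0 ^+ i = (u 0 0 / u 0 1) ^+ i * u 0 1 ^+ i by rewrite -exprMn divfK.
by move: (_ / _) => x; ring.
Qed.

Lemma hval_infty r u : u 0 1 = 0 -> hval r u = r`_e * u 0 0 ^+ e.
Proof.
move=> u1; rewrite /hval big_ord_recr /= subnn mulr1 big1 ?add0r // => i _.
by rewrite u1 expr0n subn_eq0 leqNgt ltn_ord !mulr0.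
Qed.

Lemma hval_scale r c u : hval r (c *: u) = c ^+ e * hval r u.
Proof.
rewrite mulr_sumr; apply: eq_bigr => i _; rewrite !mxE !exprMn.
have -> : c ^+ e = c ^+ i * c ^+ (e - i) by rewrite -exprD subnKC // -ltnS.
ring.
Qed.

Definition ratvec u : 'rV[K]_2 := vec2 (hval p u) (hval q u).

Lemma ratvec0 : ratvec 0 = 0.
Proof.
have H r : hval r 0 = 0 by rewrite hval_infty ?mxE // expr0n eqn0Ngt e_gt0 mulr0.
by apply: row2_eq; rewrite mxE /= H mxE.
Qed.

Lemma no_common_root x : q.[x] = 0 -> p.[x] != 0.
Proof.
move=> qx; apply/negP => px.
by have := coprimep_root cpq px; rewrite qx eqxx.
Qed.

Lemma lead_neq0 : q`_e = 0 -> p`_e != 0.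
Proof.
have lead (r : {poly K}) : size r = e.+1 -> r`_e != 0.
  by move=> sr; rewrite -[e]/(e.+1.-1) -sr -lead_coefE lead_coef_eq0 -size_poly_gt0 sr.
move=> qe; have: size q != e.+1 by apply/eqP => /lead; rewrite qe eqxx.
move=> nsq; apply: lead; move: nsq.
by move: e_gt0; rewrite /e; lia.
Qed.

(** At an affine point coprimality excludes a common root; at infinity p or q attains degree [e] and
    has a nonzero coefficient there. *)
Lemma ratvec_neq0 u : u != 0 -> ratvec u != 0.
Proof.
move=> u0; apply/eqP => E.
have Ep : hval p u = 0 by move/rowP/(_ 0): E; rewrite !mxE.
have Eq : hval q u = 0 by move/rowP/(_ 1): E; rewrite !mxE.
have [u1|u1] := eqVneq (u 0 1) 0; last first.
  move/eqP: Eq; rewrite (hval_affine sq u1) mulf_eq0 expf_eq0 (negPf u1) andbF /= => /eqP/no_common_root.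
  by move/eqP: Ep; rewrite (hval_affine sp u1) mulf_eq0 expf_eq0 (negPf u1) andbF /= => ->.
have u00 : u 0 0 ^+ e != 0.
  by rewrite expf_neq0 //; apply: contraNneq u0 => u00; apply/eqP/row2_eq; rewrite mxE.
move/eqP: Eq; rewrite (hval_infty _ u1) mulf_eq0 (negPf u00) orbF => /eqP/lead_neq0.
by move/eqP: Ep; rewrite (hval_infty _ u1) mulf_eq0 (negPf u00) orbF => ->.
Qed.

(** By [ratvec_neq0] the spanned space is a line, so [insubd] returns it and not the default [P]. *)
Definition ratmap P : proj K 1 := insubd P <[ratvec (vpick (line P))]>%VS.

Lemma ratmapE P u : u != 0 -> u \in line P -> line (ratmap P) = <[ratvec u]>%VS.
Proof.
move=> u0 uP; set t := vpick (line P).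
have tP : t \in line P by apply: memv_pick.
have t0 : t != 0 by rewrite vpick0 -dimv_eq0 (eqP (valP P)).
rewrite /line val_insubd dim_vline ratvec_neq0 //= -/t.
have /vlineP[c Et] : t \in <[u]>%VS by rewrite -(line_span u0 uP).
have c0 : c != 0 by apply: contraNneq t0 => c0; rewrite Et c0 scale0r.
have Er : ratvec t = c ^+ e *: ratvec u.
  by apply: row2_eq; rewrite !mxE /= Et hval_scale.
apply/esym/eqP; rewrite eqEdim -memvE; apply/andP; split; last by rewrite !dim_vline !ratvec_neq0.
by rewrite Er; apply/vlineP; exists (c ^+ e)^-1; rewrite scalerK // expf_neq0.
Qed.

Lemma ratmap_affine x : q.[x] != 0 -> ratmap (affine_pt x) = affine_pt (p.[x] / q.[x]).
Proof.
move=> qx; have v0 := vec2_affine_neq0 x.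
have E := @ratmapE (affine_pt x) _ v0 (memv_line _).
have u1 : vec2 x 1 0 1 != 0 by rewrite vec2_1 oner_eq0.
have := @affine_ptP _ (ratmap (affine_pt x)) (ratvec (vec2 x 1)).
rewrite E memv_line vec2_0 vec2_1 !hval_affine // vec2_0 vec2_1 expr1n !mul1r divr1.
by apply.
Qed.

Lemma ratmap_pole x : q.[x] = 0 -> ratmap (affine_pt x) = infty_pt K.
Proof.
move=> qx; have v0 := vec2_affine_neq0 x.
have E := @ratmapE (affine_pt x) _ v0 (memv_line _).
apply: (infty_ptP (ratvec_neq0 v0)); first by rewrite E memv_line.
by rewrite vec2_1 hval_affine ?vec2_0 ?vec2_1 ?oner_eq0 // divr1 qx mulr0.
Qed.

Lemma ratmap_infty y : ratmap (infty_pt K) = affine_pt y -> q`_e != 0 /\ y = p`_e / q`_e.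
Proof.
move=> Ey; have v0 := vec2_infty_neq0 K.
have := @ratmapE (infty_pt K) _ v0 (memv_line _); rewrite Ey => E.
have : ratvec (vec2 1 0) \in line (affine_pt y) by rewrite E memv_line.
move/mem_affine; rewrite vec2_0 vec2_1 !hval_infty ?vec2_0 ?vec2_1 // expr1n !mulr1 => Ep.
have qe : q`_e != 0.
  by apply/eqP => qe; have := lead_neq0 qe; rewrite Ep qe mulr0 eqxx.
by split=> //; rewrite Ep mulfK.
Qed.

Variables (n : nat) (X : proj K n -> Prop) (f : proj K n -> proj K 1).

Definition comp_forms (A : 'I_2 -> {mpoly K[n.+1]}) (i : 'I_2) : {mpoly K[n.+1]} :=
  hpoly e (if i == 0 then p else q) (A 0) (A 1).

Lemma forms_eval_comp A v : forms_eval (comp_forms A) v = ratvec (forms_eval A v).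
Proof.
have H (r : {poly K}) : mp_eval (hpoly e r (A 0) (A 1)) v = hval r (forms_eval A v).
  rewrite mp_eval_sum; apply: eq_bigr => i _.
  by rewrite mp_evalZ mp_evalM !mp_evalXn !mxE.
by apply: row2_eq; rewrite !mxE /comp_forms H.
Qed.

Lemma represents_comp d A : represents X f d A ->
  represents X (ratmap \o f) (d * e) (comp_forms A).
Proof.
case=> hA repA; split=> [i|P v XP vP]; first exact: hpoly_homog.
rewrite forms_eval_comp => rv0.
have Av0 : forms_eval A v != 0 by apply: contraNneq rv0 => ->; rewrite ratvec0.
by apply: ratmapE => //; rewrite (repA P v XP vP Av0) memv_line.
Qed.

Lemma morphism_comp : morphism X f -> morphism X (ratmap \o f).
Proof.
move=> morf P XP; have [d [A [repA [v vP Av0]]]] := morf P XP.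
exists (d * e)%N, (comp_forms A); split; first exact: represents_comp.
by exists v => //; rewrite forms_eval_comp ratvec_neq0.
Qed.

(** The chain rule, with (p' q - p q') / q^2 the derivative of p/q. *)
Lemma unramified_comp (P : proj K n) x : X P -> f P = affine_pt x -> q.[x] != 0 ->
  (p^`() * q - p * q^`()).[x] != 0 -> unramified_at X f P ->
  unramified_at X (ratmap \o f) P.
Proof.
move=> XP fP qx Wx [d [A [v [repA vP Av0 unr]]]].
exists (d * e)%N, (comp_forms A), v; split=> //.
- exact: represents_comp.
- by rewrite forms_eval_comp ratvec_neq0.
have lfP : line (f P) = <[forms_eval A v]>%VS by case: repA => _; apply.
have AfP : forms_eval A v \in line (f P) by rewrite lfP memv_line.
move=> w Tw; rewrite (ratmapE Av0 AfP) => /vlineP[la Ela]; apply: unr => //.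
have Ea : mp_eval (A 0) v = x * mp_eval (A 1) v.
  by move: AfP; rewrite fP => /mem_affine; rewrite !mxE.
have b0 : mp_eval (A 1) v != 0.
  by apply: contraNneq Av0 => b0; apply/eqP/row2_eq; rewrite !mxE ?Ea b0 ?mulr0.
set b := mp_eval (A 1) v in Ea b0.
pose mu := mp_diff (A 1) v w / b; pose eps := (mp_diff (A 0) v w - mu * mp_eval (A 0) v) / b.
have Db : mp_diff (A 1) v w = mu * b by rewrite /mu divfK.
have Da : mp_diff (A 0) v w = mu * mp_eval (A 0) v + eps * b by rewrite /eps divfK // addrC subrK.
(* If the composite differential kills [w], this equation holds for both p and q. Eliminating the
   common factor [la - e%:R * mu] leaves [eps] times (p' q - p q')(x) equal to 0, hence
   [eps = 0]. *)
have D (r : {poly K}) : (size r <= e.+1)%N ->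
    mp_diff (hpoly e r (A 0) (A 1)) v w = la * hval r (forms_eval A v) ->
    eps * r^`().[x] = (la - e%:R * mu) * r.[x].
  move=> sr; rewrite (mp_diff_hpoly Ea Db Da) // hval_affine ?mxE // Ea mulfK // [la * _]mulrCA.
  by move=> H; rewrite mulrBl -(mulfI (expf_neq0 e b0) H); ring.
have Dp := D p sp; have {D} Dq := D q sq.
move/rowP: Ela => Ela; have E0 := Ela 0; have E1 := Ela 1.
rewrite !mxE /comp_forms /= in E0 E1.
have eps0 : eps = 0.
  apply/eqP; apply: contraTT Wx => eps0; rewrite negbK -(mulrI_eq0 _ (mulfI eps0)).
  rewrite hornerD hornerN !hornerM mulrBr mulrA (Dp E0) [eps * _]mulrCA (Dq E1).
  by apply/eqP; ring.
rewrite lfP; apply/vlineP; exists mu; apply: row2_eq; rewrite !mxE //.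
by rewrite Da eps0 mul0r addr0.
Qed.

(** The lists contain affine points only; branching over infinity is always permitted. So infinity
    has to go to infinity or into [l'], and any affine point mapped outside [l'] and infinity has to
    be off [l] and not critical. *)
Variables (l l' : seq K).
Hypothesis (infty_l' : q`_e = 0 \/ p`_e / q`_e \in l').
Hypothesis (branch_l' : forall x, q.[x] != 0 -> p.[x] / q.[x] \notin l' ->
  x \notin l /\ (p^`() * q - p * q^`()).[x] != 0).

Lemma ratmap_affineP y P : y \notin l' ->
  ratmap P = affine_pt y <-> exists x, [/\ P = affine_pt x, q.[x] != 0 & y = p.[x] / q.[x]].
Proof.
move=> yl'; split=> [EP|[x [-> qx ->]]]; last by rewrite ratmap_affine.
have [EI|/affine_coordK] := eqVneq P (infty_pt K).
  move: EP; rewrite EI => /ratmap_infty[qe Ey].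
  by case: infty_l' => [/eqP|]; rewrite ?(negPf qe) // -Ey (negPf yl').
set x := affine_coord P => Ex; exists x; rewrite -Ex in EP *.
have qx : q.[x] != 0.
  by apply/eqP => qx; move: EP; rewrite ratmap_pole // => /esym/eqP; rewrite (negPf (affine_neq_infty y)).
by split=> //; move: EP; rewrite ratmap_affine // => /(can_inj (@affine_ptK K)).
Qed.

Lemma unbranched_comp y : (forall x, x \notin l -> unbranched_at X f (affine_pt x)) ->
  y \notin l' -> unbranched_at X (ratmap \o f) (affine_pt y).
Proof.
move=> unb yl' P XP /(ratmap_affineP _ yl')[x [fP qx Ey]].
have [|xl Wx] := branch_l' qx; first by rewrite -Ey.
by apply: (unramified_comp XP fP) => //; apply: unb fP.
Qed.

(** The fibre is the root set of r = p - y q. Its degree is exactly [e] because infinity does not go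
    to y, and it is separable because a common root of r and r' is a zero of p' q - p q'. *)
Lemma affine_fibre y : y \notin l' -> exists s : seq K, [/\ uniq s, size s = e &
  forall x, x \in s <-> q.[x] != 0 /\ y = p.[x] / q.[x]].
Proof.
move=> yl'; pose r := p - y *: q.
have re : r`_e != 0.
  rewrite coefB coefZ subr_eq0; apply/eqP => Ep.
  case: infty_l' => [qe|]; first by have := lead_neq0 qe; rewrite Ep qe mulr0 eqxx.
  have [qe|qe] := eqVneq q`_e 0; first by have := lead_neq0 qe; rewrite Ep qe mulr0 eqxx.
  by rewrite Ep mulfK // (negPf yl').
have sr : size r = e.+1.
  apply/eqP; rewrite eqn_leq; apply/andP; split; last first.
    by rewrite ltnNge; apply: contra re => /(nth_default 0) ->.
  apply: leq_trans (size_polyD _ _) _; rewrite size_polyN geq_max sp.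
  exact: leq_trans (size_scale_leq _ _) sq.
have rootr x : root r x <-> q.[x] != 0 /\ y = p.[x] / q.[x].
  rewrite /root hornerD hornerN hornerZ subr_eq0; split=> [/eqP E|[qx ->]]; last by rewrite divfK.
  have qx : q.[x] != 0.
    by apply/eqP => qx; have := no_common_root qx; rewrite E qx mulr0 eqxx.
  by split=> //; rewrite E mulfK.
have [s Es] := closed_field_poly_normal r.
have lc0 : lead_coef r != 0 by rewrite lead_coef_eq0 -size_poly_gt0 sr.
have roots x : (x \in s) = root r x by rewrite Es rootZ // root_prod_XsubC.
exists s; split; last by move=> x; rewrite roots.
  rewrite -separable_prod_XsubC -(eqp_separable (eqp_scale _ lc0)) -Es unlock.
  apply: Pdiv.ClosedField.root_coprimep => x /rootr[qx Ey].
  have [|_] := branch_l' qx; first by rewrite -Ey.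
  apply: contra; rewrite derivB derivZ !hornerE subr_eq0 => /eqP ->.
  rewrite Ey; apply/eqP; field; exact: qx.
by have := size_prod_XsubC s id; rewrite -(size_scale _ lc0) -Es sr => -[].
Qed.

Lemma has_degree_comp d : has_degree X f d -> has_degree X (ratmap \o f) (e * d).
Proof.
(* Off [l'] and infinity the fibre of p/q has e points; off the images of [B] each of these has d
   preimages under f. *)
case=> B HB; exists (infty_pt K :: map (@affine_pt K) l' ++ map ratmap B) => y0.
rewrite inE mem_cat !negb_or => /and3P[/affine_coordK <-]; set y := affine_coord y0 => yl' yB.
have {}yl' : y \notin l' by apply: contra yl' => yl'; apply: map_f.
have [s [us ss Hs]] := affine_fibre yl'.
have HS z : exists t : seq (proj K n), affine_pt z \notin B ->
    [/\ uniq t, size t = d & forall P : proj K n, P \in t <-> X P /\ f P = affine_pt z].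
  case: (boolP (affine_pt z \in B)) => [_|/HB[t Ht]]; first by exists [::].
  by exists t.
have [S {}HS] := choice_fun HS.
have sB z : z \in s -> affine_pt z \notin B.
  case/Hs => qz Ey; apply: contra yB => zB.
  by rewrite Ey -ratmap_affine // map_f.
have [|uS sS] := @flatten_fibres _ _ S (@affine_coord K \o f) d s us.
  move=> z /sB/HS[uz sz Hz]; split=> // P /Hz[_ /= ->]; exact: affine_ptK.
exists (flatten (map S s)); split=> //; first by rewrite sS ss.
move=> P; split=> [/flattenP[_ /mapP[z zs ->]]|[XP /(ratmap_affineP _ yl')[x [fP qx Ey]]]].
  have [_ _ Hz] := HS z (sB z zs); case/Hz => XP fP; split=> //.
  by apply/ratmap_affineP => //; exists z; have /Hs[] := zs; split.
have xs : x \in s by apply/Hs.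
apply/flattenP; exists (S x); first exact: map_f.
by have [_ _ Hx] := HS x (sB x xs); apply/Hx.
Qed.

End Composition.

(** * Functions of odd degree with controlled branching *)

Section Good.
Variables (K : numClosedFieldType) (n : nat) (X : proj K n -> Prop).
Implicit Types (f g : proj K n -> proj K 1) (l : seq K).

(** The branch points lie in [l] together with infinity, so the list [0, 1] describes a Belyi
    function of odd degree. *)
Definition odd_branched f l := [/\ morphism X f, odd_degree X f &
  forall x, x \notin l -> unbranched_at X f (affine_pt x)].

Lemma odd_branched_comp f l l' (p q : {poly K}) (e := (maxn (size p) (size q)).-1) :
  coprimep p q -> odd e -> q`_e = 0 \/ p`_e / q`_e \in l' ->
  (forall x, q.[x] != 0 -> p.[x] / q.[x] \notin l' ->
    x \notin l /\ (p^`() * q - p * q^`()).[x] != 0) ->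
  odd_branched f l -> exists g, odd_branched g l'.
Proof.
move=> cpq odde infl brl [morf [d degf oddd] unb]; have e0 := odd_gt0 odde.
exists (ratmap p q \o f); split.
- exact: morphism_comp.
- by exists (e * d)%N; [apply: has_degree_comp brl _ _|rewrite oddM odde].
- by move=> y; apply: unbranched_comp unb.
Qed.

Lemma odd_branched_poly f l l' (p : {poly K}) : odd (size p).-1 ->
  (forall x, p.[x] \notin l' -> x \notin l /\ p^`().[x] != 0) ->
  odd_branched f l -> exists g, odd_branched g l'.
Proof.
move=> oddp brl; have E : (maxn (size p) (size (1 : {poly K}))).-1 = (size p).-1.
  by rewrite size_poly1; case: (size p) oddp => [|[|m]].
apply: (@odd_branched_comp f l l' p 1); rewrite ?E ?coprimep1 //.
  (* Being odd, the degree of p is positive, so the constant 1 has coefficient 0 there: infinity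
     goes to infinity. *)
  by left; rewrite coef1; case: (size p).-1 oddp.
move=> x _; rewrite hornerC divr1 => /brl.
by rewrite mulr1 derivC mulr0 subr0.
Qed.

Lemma odd_branched_belyi f : odd_branched f [:: 0; 1] -> belyi X f /\ odd_degree X f.
Proof.
case=> morf degf unb; split=> //; split=> //.
  (* An odd degree is nonzero, so almost every point of the line is a value of f; two distinct ones
     show that f is not constant. *)
  case: degf => d [B HB] d_odd.
  pose r := \prod_(c <- map (@affine_coord K) B) ('X - c%:P).
  have r0 : r != 0 by rewrite monic_neq0 // monic_prod_XsubC.
  have pt (t : {poly K}) : t != 0 -> exists x P, [/\ ~~ root t x, X P & f P = affine_pt x].
    move=> t0; have /closed_nonrootP[x] : t * r != 0 by rewrite mulf_neq0.
    rewrite rootM negb_or root_prod_XsubC => /andP[tx xB]; exists x.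
    have [|[|P s] [_ Es Hs]] := HB (affine_pt x).
    - by apply: contra xB => xB; apply/mapP; exists (affine_pt x); rewrite ?affine_ptK.
    - by rewrite -Es in d_odd.
    have [XP fP] : X P /\ f P = affine_pt x by apply/Hs; rewrite mem_head.
    by exists P.
  have [x [P [_ XP fP]]] := pt 1 (oner_neq0 _).
  have [y [Q [nyx XQ fQ]]] := pt ('X - x%:P) (negbT (polyXsubC_eq0 x)).
  exists P, Q; split=> //; rewrite fP fQ => /(can_inj (@affine_ptK K)) E.
  by move: nyx; rewrite root_XsubC E eqxx.
move=> y; rewrite !inE !negb_or => /and3P[y0 y1 /affine_coordK Ey]; rewrite -Ey.
apply: unb; rewrite !inE negb_or.
by apply/andP; split; [apply: contra y0|apply: contra y1] => /eqP <-; rewrite Ey.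
Qed.

End Good.

(** * Belyi's reduction in odd degree *)

Local Notation pQtoC := (map_poly (ratr : rat -> algC)).

Lemma exists_nonroot (R : numDomainType) (p : {poly R}) : p != 0 -> exists c, p.[c] != 0.
Proof.
move=> p0; pose rs : seq R := [seq i%:R | i <- iota 0 (size p)].
have: ~~ all (root p) rs.
  apply/negP => /(max_poly_roots p0) H; have := H _; rewrite size_map size_iota ltnn.
  suff -> : uniq rs by move/(_ isT).
  by rewrite map_inj_uniq ?iota_uniq // => i j /eqP; rewrite eqr_nat => /eqP.
by case/allPn => c _ pc; exists c.
Qed.

Lemma size_deriv (R : numDomainType) (p : {poly R}) : size p^`() = (size p).-1.
Proof.
case Es: (size p) => [|[|k]]; first by move/eqP: Es; rewrite size_poly_eq0 => /eqP ->; rewrite deriv0 size_poly0.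
  by have /size1_polyC -> : (size p <= 1)%N by [rewrite Es]; rewrite derivC size_poly0.
rewrite /deriv Es; apply: size_poly_eq; rewrite mulrn_eq0 negb_or /=.
by rewrite -[k.+1]/(k.+2.-1) -Es -lead_coefE lead_coef_eq0 -size_poly_gt0 Es.
Qed.

(** With D the degree of s, the D + 1 powers of f up to f^D are dependent modulo s. The resulting r
    vanishes at the values of f at all roots of s. *)
Lemma power_relation (F : fieldType) (s f : {poly F}) : s != 0 ->
  exists r : {poly F}, [/\ r != 0, (size r <= size s)%N & s %| r \Po f].
Proof.
move=> s0; pose D := (size s).-1.
have ED : D.+1 = size s by rewrite prednK // size_poly_gt0.
have [|c [[i ci] Hc]] := @linear_dependence F 'I_D.+1 'I_D (fun i j => (f ^+ i %% s)`_j).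
  by rewrite !card_ord.
pose r := \poly_(i < D.+1) c (inord i).
have rE : r \Po f = \sum_(i < D.+1) c i *: f ^+ i.
  rewrite comp_polyE (big_ord_widen _ (fun i => r`_i *: f ^+ i) (size_poly _ _)) big_mkcond.
  apply: eq_bigr => j _; rewrite /r; case: ltnP => [_|/(nth_default 0)].
    by rewrite coef_poly ltn_ord inord_val.
  by rewrite coef_poly ltn_ord inord_val => ->; rewrite scale0r.
exists r; split.
- by apply/eqP => /polyP/(_ i)/eqP; rewrite coef_poly ltn_ord inord_val coef0; apply/negP.
- by rewrite -ED size_poly.
apply/modp_eq0P; rewrite rE.
have -> : (\sum_(i < D.+1) c i *: f ^+ i) %% s = \sum_(i < D.+1) c i *: (f ^+ i %% s).
  apply: (big_ind2 (fun x y => x %% s = y)) => [|x1 y1 x2 y2 <- <-|j _]; first exact: mod0p.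
    exact: modpD.
  exact: modpZl.
apply/polyP => j; rewrite coef0 coef_sum; under eq_bigr do rewrite coefZ.
have [ltj|lej] := ltnP j D; first exact: (Hc (Ordinal ltj)).
rewrite big1 // => k _; rewrite nth_default ?mulr0 //; apply: leq_trans lej.
have : (size (f ^+ k %% s)%R < size s)%N by rewrite ltn_modp.
by rewrite -ED ltnS.
Qed.

Section Arithmetic.
Variables (n : nat) (X : proj algC n -> Prop).
Local Notation odd_branched := (@odd_branched algC n X).

Lemma ratr_horner (p : {poly rat}) c : (pQtoC p).[ratr c] = ratr p.[c].
Proof. exact: horner_map. Qed.

(** [p] sends the roots of r to 0, and its critical points are rational or among fewer than deg r
    further ones, the roots of [s]. *)
Lemma belyi_polynomial (r : {poly rat}) : (1 < size r)%N ->
  exists (p s : {poly rat}) (c : seq rat), [/\ odd (size p).-1, r %| p, s != 0,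
    (size s < size r)%N & forall x, root (pQtoC p^`()) x -> x \in map ratr c \/ root (pQtoC s) x].
Proof.
move=> r1; have r0 : r != 0 by rewrite -size_poly_gt0 ltnW.
have r'0 : r^`() != 0 by rewrite -size_poly_eq0 size_deriv -lt0n ltn_predRL.
case: (boolP (odd (size r).-1)) => [oddr|evenr].
  by exists r, r^`(), [::]; split=> // [|x]; [rewrite lt_size_deriv|right].
have [c r'c] := exists_nonroot r'0.
(* With this a, the derivative of p at c is r(c) + (c - a) r'(c) = 0. Splitting off X - c from p'
   lowers its degree, which equals deg r, by one. *)
pose a := c + r.[c] / r^`().[c]; pose p := ('X - a%:P) * r.
have p'c : root p^`() c.
  rewrite /root /p derivM derivXsubC mul1r hornerD hornerM hornerXsubC /a.
  by apply/eqP; field.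
have sp : size p = (size r).+1 by rewrite size_monicM ?monicXsubC // size_XsubC.
case/factor_theorem: p'c => s Es; exists p, s, [:: c].
have p'0 : p^`() != 0 by rewrite -size_poly_eq0 size_deriv sp -lt0n ltnW.
have s0 : s != 0 by apply: contraNneq p'0 => s0; rewrite Es s0 mul0r.
have ss : size p^`() = (size s).+1 by rewrite Es mulrC size_monicM ?monicXsubC // size_XsubC.
split=> //.
- by rewrite sp /=; case: (size r) r1 evenr => //= k _; rewrite negbK => ->.
- exact: dvdp_mull.
- by rewrite size_deriv sp /= in ss; rewrite ss.
move=> x; rewrite Es rmorphM rootM /= map_polyXsubC root_XsubC => /orP[|/eqP ->]; first by right.
by left; rewrite mem_head.
Qed.

(** Induction on the degree of a rational r whose roots contain the irrational branch points. After
    applying p, rational branch points stay rational, the roots of r become 0, and only the values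
    of p at the roots of s may be irrational. *)
Lemma rational_branching_ind N f l (r : {poly rat}) : odd_branched f l ->
  r != 0 -> (size r <= N.+1)%N ->
  (forall x, x \in l -> x \in Crat \/ root (pQtoC r) x) ->
  exists g l', odd_branched g l' /\ {subset l' <= Crat}.
Proof.
elim: N f l r => [|N IH] f l r gf r0 sr lr.
  exists f, l; split=> // x /lr[//|].
  have /size_poly1P[c c0 ->] : size r == 1%N by rewrite eqn_leq sr size_poly_gt0.
  by rewrite map_polyC rootC fmorph_eq0 (negPf c0).
have [r1|] := leqP (size r) 1; first by apply: (IH f l r) => //; apply: leq_trans r1 _.
case/belyi_polynomial => p [s [c [oddp rp s0 ssr p'P]]].
(* [r2] vanishes at these values and has degree at most deg s < deg r. *)
have [r2 [r20 sr2 sr2p]] := power_relation p s0.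
have [zs Ezs] := closed_field_poly_normal (pQtoC s).
have zsP x : root (pQtoC s) x = (x \in zs).
  by rewrite Ezs rootZ ?root_prod_XsubC // lead_coef_eq0 map_poly_eq0.
pose l' := map (horner (pQtoC p)) (l ++ map ratr c ++ zs).
have [|x|g gg] := @odd_branched_poly _ _ X f l l' (pQtoC p) _ _ gf.
- by rewrite size_map_poly.
- move=> xl'; have {}xl' : x \notin l ++ map ratr c ++ zs by apply: contra xl'; apply: map_f.
  move: xl'; rewrite !mem_cat !negb_or => /and3P[xl xc xzs]; split=> //.
  apply/negP; rewrite deriv_map => /p'P; rewrite zsP (negPf xc) (negPf xzs).
  by case.
apply: (IH g l' r2) => //.
  by rewrite (leq_trans sr2) // -ltnS (leq_trans ssr).
move=> _ /mapP[x + ->]; rewrite !mem_cat => /or3P[/lr[/CratP[a ->]|rx]|/mapP[a _ ->]|].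
- by left; rewrite ratr_horner; apply/CratP; exists p.[a].
- left; suff -> : (pQtoC p).[x] = 0 by rewrite rpred0.
  by case/dvdpP: rp => t ->; rewrite rmorphM hornerM (eqP rx) mulr0.
- by left; rewrite ratr_horner; apply/CratP; exists p.[a].
rewrite -zsP => sx; right; rewrite /root -horner_comp -map_comp_poly.
by case/dvdpP: sr2p => t ->; rewrite rmorphM hornerM (eqP sx) mulr0.
Qed.

Lemma rational_branching f l : odd_branched f l ->
  exists g l', odd_branched g l' /\ {subset l' <= Crat}.
Proof.
move=> gf; suff [r [r0 Hr]] : exists r : {poly rat}, r != 0 /\ forall x, x \in l -> root (pQtoC r) x.
  by apply: (rational_branching_ind gf r0 (leqnSn _)) => x /Hr; right.
elim: (l) => [|x s [r [r0 Hr]]]; first by exists 1; rewrite oner_eq0.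
have [m [Em mon_m _]] := minCpolyP x.
exists (m * r); split; first by rewrite mulf_neq0 // monic_neq0.
move=> y; rewrite inE rmorphM rootM => /predU1P[->|/Hr ->]; last by rewrite orbT.
by rewrite /= -Em root_minCpoly.
Qed.

(** An affine map D x + c has odd degree 1 and no critical points; D clears the denominators and c
    makes the images positive. *)
Lemma integral_branching f l : odd_branched f l -> {subset l <= Crat} ->
  exists g (b : seq int), odd_branched g (map intr b) /\ forall z, z \in b -> 0 < z.
Proof.
move=> gf lQ.
have [D [c [D0 Hc]]] : exists (D : int) (c : nat), D != 0 /\
    forall x, x \in l -> exists m : nat, D%:~R * x + c%:R = m.+1%:R.
  elim: l lQ {gf} => [|x s IH] lQ; first by exists 1, 0%N.
  have [D [c [D0 Hc]]] := IH (fun y ys => lQ y (mem_behead (s := x :: s) ys)).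
  have /CratP[a Ea] := lQ x (mem_head _ _).
  pose k := `|denq a|%N; pose z := D * numq a.
  pose t := `|z|%N; have Ek : Posz k = denq a by rewrite gez0_abs.
  have k0 : (k%:R : algC) = (denq a)%:~R by rewrite -Ek.
  have Dx : (D * k)%:~R * x = z%:~R.
    have -> : x = (numq a)%:~R / (denq a)%:~R.
      by rewrite Ea -{1}[a]divq_num_den fmorph_div /= !ratr_int.
    by rewrite Ek /z !intrM; field; rewrite intr_eq0 denq_neq0.
  (* For the new point, [(D * k) * x = z] and t = |z|, so adding k c + t + 1 gives a positive
     integer. An older point, sent to m + 1 before, now goes to k (m + 1) + t + 1. *)
  exists (D * k), (k * c + t.+1)%N; split; first by rewrite mulf_neq0 // Ek denq_neq0.
  move=> y; rewrite inE => /predU1P[->|/Hc[m Hm]].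
    exists `|(z + Posz (k * c + t))%R|%N; rewrite Dx.
    have Ez : Posz `|(z + Posz (k * c + t))%R|%N = z + Posz (k * c + t) by rewrite gez0_abs // /t; lia.
    rewrite -[_.+1%:R in RHS]natr1 -[_%:R in RHS]/((Posz _)%:~R) Ez intrD.
    by rewrite addnS -natr1 addrA.
  exists (k * m.+1 + t)%N; rewrite -addnS !natrD !natrM -Hm rmorphM /=; ring.
have [m Hm] : exists m : algC -> nat, forall x, x \in l -> D%:~R * x + c%:R = (m x).+1%:R.
  have H x : exists k : nat, x \in l -> D%:~R * x + c%:R = k.+1%:R.
    by case: (boolP (x \in l)) => [/Hc[k Hk]|_]; [exists k|exists 0%N].
  exact: choice_fun H.
pose b : seq int := map (fun x => Posz (m x).+1) l.
pose p : {poly algC} := D%:~R *: 'X + c%:R%:P.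
have [||g gg] := @odd_branched_poly _ _ X f l (map intr b) p _ _ gf.
- have sD : size (D%:~R *: 'X : {poly algC}) = 2 by rewrite size_scale ?size_polyX // intr_eq0.
  by rewrite size_polyDl sD // size_polyC; case: (_ != 0).
- have p' : p^`() = D%:~R%:P by rewrite derivD derivZ derivX derivC addr0 alg_polyC.
  have px x : p.[x] = D%:~R * x + c%:R by rewrite hornerD hornerZ hornerX hornerC.
  move=> x; rewrite px p' hornerC intr_eq0 => xb; split=> //.
  apply: contra xb => xl; rewrite (Hm x xl); apply/mapP; exists (Posz (m x).+1) => //.
  exact: map_f.
by exists g, b; split=> // _ /mapP[x _ ->].
Qed.

End Arithmetic.

(** * Products of powers of linear factors and their logarithmic derivatives *)

Section WeightedProduct.
Variable K : numFieldType.
Implicit Types (s : seq int) (k : int -> nat) (x : K).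

Definition wprod k s : {poly K} := \prod_(b <- s) ('X - b%:~R%:P) ^+ k b.

Lemma wprod_monic k s : wprod k s \is monic.
Proof. by apply: monic_prod => b _; apply/monic_exp/monicXsubC. Qed.

Lemma size_wprod k s : size (wprod k s) = (\sum_(b <- s) k b).+1.
Proof.
elim: s => [|b s IH]; first by rewrite /wprod !big_nil size_poly1.
rewrite /wprod !big_cons size_monicM ?monic_exp ?monicXsubC ?monic_neq0 ?wprod_monic //.
by rewrite -/(wprod k s) IH size_exp_XsubC addnS addSn.
Qed.

Lemma root_wprod k s x : root (wprod k s) x -> exists2 b, b \in s & (0 < k b)%N /\ x = b%:~R.
Proof.
rewrite /root horner_prod prodf_seq_eq0 => /hasP[b bs].
rewrite horner_exp hornerXsubC expf_eq0 subr_eq0 /= => /andP[kb /eqP ->].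
by exists b.
Qed.

Lemma wprod_root k s b : b \in s -> (0 < k b)%N -> root (wprod k s) b%:~R.
Proof.
move=> bs kb; rewrite /root horner_prod prodf_seq_eq0; apply/hasP; exists b => //=.
by rewrite horner_exp hornerXsubC subrr expr0n; case: (k b) kb.
Qed.

Lemma wprod_log_derivative k s x : (forall b, b \in s -> x != b%:~R) ->
  (wprod k s)^`().[x] = (wprod k s).[x] * \sum_(b <- s) (k b)%:R / (x - b%:~R).
Proof.
elim: s => [|b s IH] xs; first by rewrite /wprod !big_nil derivC horner0 mulr0.
have xb : x - b%:~R != 0 by rewrite subr_eq0 xs ?mem_head.
rewrite /wprod !big_cons -!/(wprod k s) derivM !hornerE IH => [|c cs]; last first.
  by rewrite xs // inE cs orbT.
rewrite deriv_exp derivXsubC mul1r hornerMn !horner_exp !hornerXsubC.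
case: (k b) => [|m] /=; first by rewrite expr0 mulr0n !mul0r !add0r !mul1r.
rewrite exprS -mulr_natr; move: (\sum_(_ <- _) _) (x - _) xb => S y y0; field; exact: y0.
Qed.

End WeightedProduct.

(** * Integer weights proportional to the inverses of P'(b) *)

Section Weights.
Variables (K : numFieldType) (pts : seq int) (M : int -> int) (L : int).
Hypotheses (u_pts : uniq pts) (pts_gt1 : (1 < size pts)%N)
  (HM : forall b, b \in pts -> M b * \prod_(c <- rem b pts) (b - c) = L).

Let cofactor b : {poly K} := \prod_(c <- rem b pts) ('X - c%:~R%:P).

Let size_cofactor b : b \in pts -> size (cofactor b) = size pts.
Proof.
move=> bp; rewrite /cofactor (size_prod_XsubC _ (fun c : int => c%:~R)) size_rem //.
by rewrite prednK // ltnW.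
Qed.

(** By [HM], [M b] is L / P'(b) for the monic P with simple roots [pts]. This is Lagrange
    interpolation of the constant L: both sides agree at all of [pts] and have degree below their
    number. *)
Lemma lagrange_weights : \sum_(b <- pts) (M b)%:~R *: cofactor b = (L%:~R)%:P.
Proof.
apply/eqP; rewrite -subr_eq0; apply/eqP.
apply: (@roots_geq_poly_eq0 _ _ (map intr pts)).
- apply/allP => _ /mapP[b bp ->]; rewrite /root hornerD hornerN hornerC horner_sum.
  rewrite (big_rem b) //= big_seq big1 ?addr0 => [|c cr].
    rewrite hornerZ horner_prod -(HM bp) intrM rmorph_prod subr_eq0.
    by apply/eqP; congr (_ * _); apply: eq_bigr => c _; rewrite hornerXsubC rmorphB.
  have bc : b \in rem c pts.
    by move: cr; rewrite !mem_rem_uniq // !inE eq_sym => /andP[-> _].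
  by rewrite hornerZ horner_prod (big_rem b) //= hornerXsubC subrr mul0r mulr0.
- by rewrite map_inj_uniq // => b c /eqP; rewrite eqr_int => /eqP.
rewrite size_map; apply: leq_trans (size_polyD _ _) _.
rewrite geq_max; apply/andP; split; last first.
  by rewrite size_polyN; apply: leq_trans (size_polyC_leq1 _) (ltnW pts_gt1).
rewrite big_seq.
apply: (big_ind (fun p : {poly K} => (size p <= size pts)%N)) => [|p q sp sq|b bp].
- by rewrite size_poly0.
- by apply: leq_trans (size_polyD _ _) _; rewrite geq_max sp.
by apply: leq_trans (size_scale_leq _ _) _; rewrite size_cofactor.
Qed.

(** Compare coefficients of the highest possible degree in [lagrange_weights]; that degree is
    positive because there are at least two points. *)
Lemma sum_weights : \sum_(b <- pts) M b = 0.
Proof.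
apply/eqP; rewrite -(eqr_int K) rmorph_sum /=; apply/eqP.
have /polyP/(_ (size pts).-1) := lagrange_weights.
rewrite coefC coef_sum gtn_eqF ?ltn_predRL // => H; rewrite mulr0z -[RHS]H.
rewrite big_seq [RHS]big_seq; apply: eq_bigr => b bp; rewrite coefZ -[X in _`_(X.-1)](size_cofactor bp).
by rewrite -lead_coefE (monicP _) ?mulr1 // monic_prod_XsubC.
Qed.

(** The partial fraction expansion of L / P; for nonzero L it shows that the sum has no zero. *)
Lemma sum_weights_fraction (x : K) : (forall b, b \in pts -> x != b%:~R) ->
  (\sum_(b <- pts) (M b)%:~R / (x - b%:~R)) * \prod_(b <- pts) (x - b%:~R) = L%:~R.
Proof.
move=> xp; rewrite -[RHS](hornerC _ x) -lagrange_weights horner_sum mulr_suml.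
rewrite big_seq [RHS]big_seq; apply: eq_bigr => b bp.
rewrite hornerZ horner_prod (big_rem b) //= mulrA divfK ?subr_eq0 ?xp //.
by congr (_ * _); apply: eq_bigr => c _; rewrite hornerXsubC.
Qed.

End Weights.

Definition posz_part (m : int) : nat := if m is Posz k then k else 0%N.
Definition negz_part (m : int) : nat := if m is Negz k then k.+1 else 0%N.

Lemma posz_negz_part m : m = Posz (posz_part m) - Posz (negz_part m).
Proof. by case: m => k; rewrite /posz_part /negz_part ?subr0 // NegzE sub0r. Qed.

(** * The rational map that reduces integral branch points to 0, 1 and infinity *)

Section BelyiFunction.
Variables (n : nat) (X : proj algC n -> Prop).

(** Apply the product of the (X - b)^(M b), written p/q by the signs of the exponents. As the
    weights sum to 0, p and q are monic of equal degree and infinity goes to 1. Every b goes to 0 or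
    infinity, and elsewhere the logarithmic derivative L / P does not vanish. *)
Lemma odd_branched_weights f (pts : seq int) (M : int -> int) (L : int) (l : seq algC) :
  uniq pts -> (1 < size pts)%N -> L != 0 ->
  (forall b, b \in pts -> M b * \prod_(c <- rem b pts) (b - c) = L) ->
  odd (\sum_(b <- pts) posz_part (M b)) ->
  {subset l <= map intr pts} ->
  odd_branched X f l -> exists g, odd_branched X g [:: 0; 1].
Proof.
move=> upts pts1 L0 HM oddM lpts gf.
pose kp b := posz_part (M b); pose kq b := negz_part (M b).
pose p : {poly algC} := wprod algC kp pts; pose q : {poly algC} := wprod algC kq pts.
have Epq : (\sum_(b <- pts) kq b = \sum_(b <- pts) kp b)%N.
  apply/eqP; rewrite -eqz_nat eq_sym -subr_eq0 !(big_morph Posz PoszD (erefl _)) -sumrB.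
  rewrite -[X in _ == X](sum_weights algC upts pts1 HM); apply/eqP/eq_bigr => b _.
  by rewrite [RHS]posz_negz_part.
have sq : size q = size p by rewrite !size_wprod Epq.
have sp : size p = (\sum_(b <- pts) kp b).+1 by rewrite size_wprod.
have Mn0 b : b \in pts -> M b != 0.
  by move=> /HM; apply: contra_eq_neq => ->; rewrite mul0r eq_sym.
have pts_root b : b \in pts -> root p b%:~R \/ root q b%:~R.
  move=> bp; have := Mn0 b bp; case EM: (M b) => [m|m] m0; [left|right].
    by apply: wprod_root; rewrite // /kp EM lt0n.
  by apply: wprod_root; rewrite // /kq EM.
have Ee : (maxn (size p) (size q)).-1 = (\sum_(b <- pts) kp b)%N by rewrite sq maxnn sp.
apply: (@odd_branched_comp _ _ X f l _ p q) gf; rewrite ?Ee //.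
- apply: Pdiv.ClosedField.root_coprimep => x /root_wprod[b bp [kb ->]].
  apply/negP => /root_wprod[c cp [kc /eqP]]; rewrite eqr_int => /eqP Ebc.
  by move: kb kc; rewrite /kp /kq Ebc; case: (M c).
- right; have lp : p`_(\sum_(b <- pts) kp b) = 1.
    by have /monicP := wprod_monic algC kp pts; rewrite lead_coefE -/p sp.
  have -> : q`_(\sum_(b <- pts) kp b) = 1.
    by have /monicP := wprod_monic algC kq pts; rewrite lead_coefE -/q sq sp.
  by rewrite lp divr1 !inE eqxx orbT.
move=> x qx; rewrite !inE negb_or mulf_eq0 negb_or => /andP[/andP[px _] _].
have xpts b : b \in pts -> x != b%:~R.
  by move=> /pts_root[] r; [apply: contraNneq px|apply: contraNneq qx] => ->.
split; first by apply/negP => /lpts/mapP[b /xpts/eqP].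
have H := sum_weights_fraction upts pts1 HM xpts.
pose Sp := \sum_(b <- pts) (kp b)%:R / (x - b%:~R).
pose Sq := \sum_(b <- pts) (kq b)%:R / (x - b%:~R).
have E : \sum_(b <- pts) (M b)%:~R / (x - b%:~R) = Sp - Sq.
  by rewrite -sumrB; apply: eq_bigr => b _; rewrite -mulrBl {1}[M b]posz_negz_part rmorphB.
have Dp : p^`().[x] = p.[x] * Sp := wprod_log_derivative kp xpts.
have Dq : q^`().[x] = q.[x] * Sq := wprod_log_derivative kq xpts.
have -> : (p^`() * q - p * q^`()).[x] = p.[x] * q.[x] * (Sp - Sq).
  by rewrite hornerD hornerN !hornerM Dp Dq; ring.
rewrite -E !mulf_neq0 //; apply/eqP => S0; move/eqP: H.
by rewrite S0 mul0r eq_sym intr_eq0 (negPf L0).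
Qed.


(* With O_b := 1 + 2 b |Q_b| R_b one has b + T = b O_b, where Q_b is the product
   of the b - c and R_b that of the c^2 |Q_c|, over c <> b in [s]. Hence, up to
   a common factor, the inverses of the P'(b), P = X (X + T) \prod_b (X - b),
   are the integers [Os], [-1] and, at the points of [s], even integers. *)
Lemma odd_branched_int f (bs : seq int) :
  (forall b, b \in bs -> 0 < b) -> odd_branched X f (map intr bs) ->
  exists g, odd_branched X g [:: 0; 1].
Proof.
move=> bs_gt0 gf; have [s [us Es]] : exists s, uniq s /\ s =i bs.
  by exists (undup bs); split; [apply: undup_uniq|apply: mem_undup].
have s_gt0 b : b \in s -> 0 < b by rewrite Es; apply: bs_gt0.
pose Q b : int := \prod_(c <- rem b s) (b - c).
pose R b : int := \prod_(c <- rem b s) (c ^+ 2 * `|Q c|).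
pose T : int := 2 * \prod_(c <- s) (c ^+ 2 * `|Q c|).
pose O b : int := 1 + 2 * b * `|Q b| * R b.
pose C : int := \prod_(b <- s) b.
pose E : int := (-1) ^+ size s.
have Q0 b : b \in s -> Q b != 0.
  move=> bs_; rewrite prodf_seq_neq0; apply/allP => c; rewrite mem_rem_uniq // !inE => /andP[cb _].
  by rewrite subr_eq0 eq_sym.
have W_gt0 c : c \in s -> 0 < c ^+ 2 * `|Q c|.
  by move=> cs; rewrite mulr_gt0 ?exprn_gt0 ?normr_gt0 ?Q0 ?s_gt0.
have R_gt0 b : 0 < R b.
  by rewrite /R big_seq; apply: prodr_gt0 => c /mem_rem; apply: W_gt0.
have T_gt0 : 0 < T.
  by rewrite /T mulr_gt0 // big_seq; apply: prodr_gt0 => c; apply: W_gt0.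
have TE b : b \in s -> T = 2 * (b ^+ 2 * `|Q b|) * R b.
  by move=> bs_; rewrite /T /R (big_rem b) //=; ring.
have ObE b : b \in s -> b + T = b * O b.
  by move=> bs_; rewrite (TE b) // /O; ring.
have O_gt0 b : b \in s -> 0 < O b.
  by move=> bs_; apply: ltr_wpDr => //; rewrite !mulr_ge0 ?normr_ge0 ?(ltW (R_gt0 b)) ?(ltW (s_gt0 b bs_)).
have C0 : C != 0 by rewrite prodf_seq_neq0; apply/allP => b /s_gt0; rewrite lt0r => /andP[].
have E0 : E != 0 by rewrite signr_eq0.
pose Os := \prod_(b <- s) O b.
have Os_gt0 : 0 < Os by rewrite /Os big_seq; apply: prodr_gt0 => c; apply: O_gt0.
pose pts := [:: 0, - T & s].
pose M b : int := if b == 0 then Os else if b == - T then -1 else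
  2 * (E * C * (\prod_(c <- rem b s) O c) * sgz (Q b) * R b).
have ns b : b \in s -> (b != 0) && (b != - T).
  by move=> /s_gt0 b0; rewrite gt_eqF //= gt_eqF // (lt_trans _ b0) // oppr_lt0.
have upts : uniq pts.
  have n0 : 0 \notin s by apply/negP => /ns; rewrite eqxx.
  have nT : - T \notin s by apply/negP => /ns; rewrite eqxx andbF.
  by rewrite /= inE negb_or n0 nT us eq_sym oppr_eq0 gt_eqF.
have M0 : M 0 = Os by rewrite /M eqxx.
have MT : M (- T) = -1 by rewrite /M oppr_eq0 gt_eqF // eqxx.
have Ms b : b \in s -> M b = 2 * (E * C * (\prod_(c <- rem b s) O c) * sgz (Q b) * R b).
  by move=> /ns/andP[b0 bT]; rewrite /M (negPf b0) (negPf bT).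
(* Here E C is the product of the 0 - b and E C Os that of the - T - b over [s]. At b in [s] the
   product of differences is b^2 O_b Q_b, and T = 2 b^2 |Q_b| R_b gives the same L. *)
apply: (@odd_branched_weights f pts M (T * E * C * Os) (map intr bs)) gf => //.
- have T0 : T != 0 by rewrite (gt_eqF T_gt0).
  have Os0 : Os != 0 by rewrite (gt_eqF Os_gt0).
  exact: mulf_neq0 (mulf_neq0 (mulf_neq0 T0 E0) C0) Os0.
- have rem0 : rem 0 pts = - T :: s by [].
  have remT : rem (- T) pts = 0 :: s by rewrite /= eq_sym oppr_eq0 (gt_eqF T_gt0) eqxx.
  have rems b : b \in s -> rem b pts = [:: 0, - T & rem b s].
    by case/ns/andP => b0 bT; rewrite /= !(eq_sym _ b) (negPf b0) (negPf bT).
  move=> b; rewrite !inE => /or3P[/eqP ->|/eqP ->|bs_].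
  + rewrite M0 rem0 big_cons sub0r opprK.
    have -> : \prod_(c <- s) (0 - c) = E * C.
      by rewrite /E /C; elim: (s) => [|c r IH]; rewrite ?big_nil ?mulr1 // !big_cons IH /= exprS; ring.
    ring.
  + rewrite MT remT big_cons subr0.
    have -> : \prod_(c <- s) (- T - c) = E * C * Os.
      suff H r : {subset r <= s} -> \prod_(c <- r) (- T - c) =
          (-1) ^+ size r * (\prod_(c <- r) c) * \prod_(c <- r) O c by apply: H.
      elim: r => [|c r IH] sr; first by rewrite !big_nil !mulr1.
      rewrite !big_cons IH /= => [|d dr]; last by apply: sr; rewrite inE dr orbT.
      by rewrite -opprD addrC ObE ?sr ?mem_head // exprS; ring.
    ring.
  rewrite Ms // rems // !big_cons.
  have -> : Os = O b * \prod_(c <- rem b s) O c by rewrite /Os (big_rem b).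
  rewrite subr0 opprK ObE // -/(Q b) (TE b) //.
  have -> : `|Q b| = sgz (Q b) * Q b by rewrite normrEsg sgrEz intz.
  ring.
(* The degree is the sum of the positive weights: [Os] is odd, as a product of odd O_b, the weight
   -1 contributes nothing, and all others are even. *)
- rewrite !big_cons M0 MT /= add0n oddD.
  have oddO b : odd `|O b|%N.
    by rewrite /O; lia.
  have -> : odd (posz_part Os).
    have -> : posz_part Os = `|Os|%N by move: Os_gt0; case: (Os).
    rewrite /Os; elim: (s) => [|c r IH]; first by rewrite big_nil.
    by rewrite big_cons abszM oddM oddO.
  rewrite big_seq; apply: (big_ind (fun k => odd 1 (+) odd k)) => [//|j k|b bs_].
    by rewrite oddD; case: (odd j); case: (odd k).
  rewrite Ms //; move: (_ * _ * _) => m.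
  by case: m => m; rewrite /posz_part /=; lia.
by move=> _ /mapP[b bb ->]; apply: map_f; rewrite !inE Es bb !orbT.
Qed.

End BelyiFunction.

Theorem theorem3p8 (n : nat) (X : proj algC n -> Prop) (hX : curve X)
    (hf : exists f : proj algC n -> proj algC 1,
        [/\ meromorphic X f, nonconstant X f & odd_degree X f]) :
  exists g : proj algC n -> proj algC 1, belyi X g /\ odd_degree X g.
Proof.
have [irrX dimX _] := hX; case: hf => f [merf _ oddf].
have [d degf /odd_gt0 d_gt0] := oddf.
have [l unb] := finite_branch_locus irrX dimX merf degf d_gt0.
have [g [l' [gg Ql']]] : exists g l', odd_branched X g l' /\ {subset l' <= Crat}.
  by apply: (@rational_branching n X f l); split=> //; case: merf.
have [h [b [gh b_gt0]]] := integral_branching gg Ql'.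
have [k gk] := odd_branched_int b_gt0 gh.
by exists k; apply: odd_branched_belyi.
Qed.
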